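(* Let $G$ be a finite matchstick graph with $n\geq 1$ vertices. Then the number of vertices of $G$ of degree at most $4$ (including vertices of degree $0$) is greater than $$\frac{1}{4}\sqrt{\pi\sqrt{3}\cdot n}.$$
   Context: A matchstick graph is a finite simple graph drawn in the Euclidean plane such that the vertices are distinct points, each edge $uv$ is the straight-line segment joining $u$ and $v$ and has length exactly $1$, and distinct edges intersect only at (common) endpoints. The graph is not assumed to be connected, and isolated vertices are allowed. *)

(* Defs.v *)
From HB Require Import structures.
From mathcomp Require Import all_boot all_order all_algebra.
From mathcomp Require Import reals trigo.

Set Implicit Arguments.
Unset Strict Implicit.
Unset Printing Implicit Defensive.

Import Order.TTheory GRing.Theory Num.Theory.
Local Open Scope ring_scope.

(* The Euclidean plane is R * R; its library norm is the max norm, so the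
   Euclidean distance is written out. *)
Definition eucl_dist (R : realType) (a b : R * R) : R :=
  Num.sqrt ((a.1 - b.1) ^+ 2 + (a.2 - b.2) ^+ 2).

Definition on_segment (R : realType) (a b z : R * R) : Prop :=
  exists t : R, 0 <= t <= 1 /\
    z = ((1 - t) * a.1 + t * b.1, (1 - t) * a.2 + t * b.2).

Definition deg (T : finType) (e : rel T) (v : T) : nat := #|[set w | e v w]|.

(* A simple graph on the vertex set T with adjacency relation e, drawn with
   vertex v at the point p v.  Edges are unordered pairs, hence the comparison
   of [set u; v] and [set x; y]. *)
Record matchstick_graph (R : realType) (T : finType) (e : rel T)
    (p : T -> R * R) : Prop := MatchstickGraph {
  matchstick_sym : symmetric e;
  matchstick_irr : irreflexive e;
  matchstick_inj : injective p;
  matchstick_unit : forall u v : T, e u v -> eucl_dist (p u) (p v) = 1;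
  matchstick_cross : forall (u v x y : T) (z : R * R),
    e u v -> e x y -> [set u; v] != [set x; y] ->
    on_segment (p u) (p v) z -> on_segment (p x) (p y) z ->
    exists w : T, [/\ w \in [set u; v], w \in [set x; y] & z = p w]
}.

(* Main.v *)
(** Extend the drawing [G] to a maximal noncrossing set [H] of straight segments
    on the same vertices.  By maximality every angle of [H] smaller than [pi]
    is the angle of an empty triangle, so the complement of [H] consists of
    triangles, of angle sum [pi], and of angles at least [pi].  Deleting the
    edges of [H] outside [G] one at a time merges regions; a bounded region of
    [G] with [k] sides has angle sum [pi * (k - 2 + 2 * j)], [j >= 0], and the
    outer one, with [k_o] sides, more than [pi * k_o].  Neither Euler's formula
    nor the Jordan curve theorem is needed.

    Weigh an angle 0, 1 or 2 according to whether it is at most [pi / 3],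
    between, or at least [2 * pi / 3].  As all edges have length 1, the weights
    in a bounded region add up to at most [4 * (k - 3 + 3 * j)], whereas those
    at a vertex of degree 5 add up to at least 2; summing gives [k_o < 4 * m]
    for the number [m] of vertices of degree at most 4.  Summing angles alone
    shows that there are at least [n - 4 * m + k_o] equilateral triangles, and
    by the isoperimetric inequality their area is at most
    [k_o ^ 2 / (4 * pi)].  The two estimates give
    [pi * sqrt 3 * n < 16 * m ^ 2]. *)

Require Import Defs.
From mathcomp Require Import all_boot all_order all_algebra.
From mathcomp Require Import fingroup perm.
From mathcomp Require Import reals trigo.
From mathcomp Require Import boolp normedtype derive.
From mathcomp Require Import ring lra zify.
Set Implicit Arguments.
Unset Strict Implicit.
Unset Printing Implicit Defensive.

Import numFieldNormedType.Exports.
Import Order.TTheory GRing.Theory Num.Theory.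
Local Open Scope ring_scope.

(** * Isoperimetric inequality for unit polygons *)

(** The bounds for a region with angle sum [S] are chosen to be linear in [S] and [k]. The bound on
    the weights, [4 * (k - 3 + 3 * j)], is [(6 * S - 2 * pi * k) / pi], and it is tuned to a count
    around each vertex: twice the degree plus the weights is at least 12, up to a deficit of 8 at a
    vertex of degree at most 4. In the total all bounded regions and all vertices cancel, and the
    outer region is compared with [8 * m] alone. In the same way
    [(2 * S - pi * k) / pi = k + 4 * j - 4] is -1 for a triangle with [j = 0] and nonnegative for
    every other bounded region, so it counts triangles.

    The graph may be disconnected, and a region may have several boundary components. Regions are
    therefore mere labels of darts (directed edges): all that matters is the sum of the angles, of 1
    and of [crs] over the darts with a given label, and these sums can be followed when an edge is
    deleted. The number [j] needs no interpretation; it grows by one whenever the deleted edge has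
    the same region on both sides.

    Isolated vertices have no angles; they are set aside and added at the end. *)

Lemma le_mul_cos_sin (R : realType) (x : R) :
  0 <= x <= pi -> x * cos x <= sin x.
Proof.
move=> /andP[x0 xpi].
pose f (y : R) := sin y - y * cos y.
have df (y : R) : is_derive y 1 f (y * sin y).
  rewrite /f; apply: is_derive_eq.
  rewrite /GRing.scale /=; ring.
have [|c] := MVT_segment x0 (fun y _ => df y).
  by apply: derivable_within_continuous => y _; exact: ex_derive.
rewrite in_itv /= => /andP[c0 cx].
  rewrite /f sin0 mul0r !subr0 => fx; rewrite -subr_ge0 fx.
  by rewrite !mulr_ge0 ?sin_ge0_pi ?c0 ?(le_trans cx).
Qed.

(* The constant is attained by [Y j = sin (j * t)]; [s_m * S_m - sin t *
   cos (m * t) * Y m ^ 2] stays nonnegative by completing the square. *)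
Lemma dirichlet_wirtinger (R : realType) (N : nat) (Y : nat -> R) :
  (1 < N)%N -> Y 0%N = 0 -> Y N = 0 ->
  0 <= \sum_(j < N) (cos (pi / N%:R) * (Y j ^+ 2 + Y j.+1 ^+ 2)
                     - 2 * Y j * Y j.+1).
Proof.
move=> N1 Y0 YN; set t : R := pi / N%:R.
have N0 : (0 : R) < N%:R by rewrite ltr0n; apply: ltn_trans N1.
have sm (m : nat) : (0 < m < N)%N -> 0 < sin (m%:R * t).
  move=> /andP[m0 mN]; apply: sin_gt0_pi; rewrite mulr_gt0 ?ltr0n //=; last first.
    by rewrite divr_gt0 ?pi_gt0.
  by rewrite /t mulrA ltr_pdivrMr // mulrC ltr_pM2l ?pi_gt0 // ltr_nat.
pose F j := cos t * (Y j ^+ 2 + Y j.+1 ^+ 2) - 2 * Y j * Y j.+1.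
have key (m : nat) : (0 < m < N)%N ->
    sin t * cos (m%:R * t) * Y m ^+ 2 <= sin (m%:R * t) * \sum_(j < m) F j.
  elim: m => // -[_ _|m IH /andP[_ mN]].
    by rewrite mul1r big_ord1 /F Y0 expr0n /= add0r mulr0 mul0r subr0 mulrA.
  have sm1 : 0 < sin (m.+1%:R * t) by apply: sm; rewrite /= ltnW.
  have sm2 : 0 < sin (m.+2%:R * t) by apply: sm.
  have {IH} := IH; rewrite /= ltnW // => /(_ isT) IH.
  rewrite big_ord_recr /= -(ler_pM2l sm1).
  set S := \sum_(j < _) _ in IH *.
  have -> : sin (m.+1%:R * t) * (sin (m.+2%:R * t) * (S + F m.+1)) =
    sin (m.+2%:R * t) * (sin (m.+1%:R * t) * S)
    + sin (m.+1%:R * t) * sin (m.+2%:R * t) * F m.+1 by ring.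
  apply: (@le_trans _ _ (sin (m.+2%:R * t) * (sin t * cos (m.+1%:R * t) * Y m.+1 ^+ 2)
    + sin (m.+1%:R * t) * sin (m.+2%:R * t) * F m.+1)); last first.
    by rewrite lerD2r ler_pM2l.
  have e2 : m.+2%:R * t = m.+1%:R * t + t by rewrite -natr1 mulrDl mul1r.
  rewrite -subr_ge0 /F e2 sinD cosD.
  set a := Y m.+1; set b := Y m.+2.
  set s := sin (m.+1%:R * t); set c := cos (m.+1%:R * t).
  have ct := cos2Dsin2 t; set st := sin t in ct *; set u := cos t in ct *.
  apply: (le_trans (sqr_ge0 ((s * u + c * st) * a - s * b))).
  by rewrite -[leLHS]addr0 -(mul0r (s ^+ 2 * b ^+ 2)) -(subrr 1) -{1}ct; lra.
(* [key] stops at [m = N - 1], where the sine is still positive. The last term, in which [Y N = 0],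
   is added by hand, and the coefficients of [Y (N - 1) ^ 2] combine to [sin pi]. *)
have tN : N%:R * t = pi by rewrite mulrC mulfVK ?lt0r_neq0.
case: N N1 YN @t N0 sm @F key tN => // -[//|N] _ YN t N0 sm F key tN.
have sN : 0 < sin (N.+1%:R * t) by apply: sm; rewrite /= ltnSn.
have := key N.+1; rewrite /= ltnSn => /(_ isT) h.
have sp : sin (N.+1%:R * t + t) = 0.
  by rewrite -{2}(mul1r t) -mulrDl natr1 tN sinpi.
rewrite -(pmulr_rge0 _ sN) big_ord_recr /= YN expr0n /= addr0 mulr0 subr0.
set S := \sum_(j < _) _ in h *.
have : sin (N.+1%:R * t + t) * Y N.+1 ^+ 2 = 0 by rewrite sp mul0r.
rewrite sinD; lra.
Qed.

(** The bound is twice the area of the half disc whose arc has length [N * h]. The sum telescopes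
    into trapezoids [M j] over the x-axis. AM-GM with the weights [s] and [c] bounds
    [2 * c * s * |M j|] by [c ^ 2 * h ^ 2] minus the corresponding term of [dirichlet_wirtinger]. *)
Lemma chord_area_le (R : realType) (N : nat) (X Y : nat -> R) (h : R) :
  (1 < N)%N -> Y 0%N = 0 -> Y N = 0 ->
  (forall j, (j < N)%N ->
    (X j.+1 - X j) ^+ 2 + (Y j.+1 - Y j) ^+ 2 = h ^+ 2) ->
  `|\sum_(j < N) (X j * Y j.+1 - Y j * X j.+1)| <= N%:R ^+ 2 * h ^+ 2 / pi.
Proof.
move=> N1 Y0 YN step.
have N0 : (0 : R) < N%:R by rewrite ltr0n; apply: ltn_trans N1.
have W := dirichlet_wirtinger N1 Y0 YN.
set t : R := pi / N%:R in W.
have t0 : 0 < t by rewrite divr_gt0 ?pi_gt0.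
have tpi : t <= pi / 2.
  by rewrite ler_pM2l ?pi_gt0 // lef_pV2 ?posrE // ler_nat.
have t2pi : t / 2 < pi / 2 by have := @pi_gt0 R; lra.
pose c := cos (t / 2); pose s := sin (t / 2).
have c0 : 0 < c.
  by apply: cos_gt0_pihalf; rewrite t2pi andbT; have := @pi_gt0 R; lra.
have s0 : 0 < s by apply: sin_gt0_pihalf; rewrite t2pi andbT; lra.
(* This is [x <= tan x] without division; it replaces the constant of the regular polygon by that of
   the circle. *)
have sc : t / 2 * c <= s.
  by apply: le_mul_cos_sin; have := @pi_gt0 R; lra.
have ct : cos t = c ^+ 2 - s ^+ 2 by rewrite {1}(splitr t) cosD /c /s; ring.
have c2s2 : c ^+ 2 + s ^+ 2 = 1 by exact: cos2Dsin2.
pose M j := (Y j + Y j.+1) * (X j.+1 - X j).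
have -> : \sum_(j < N) (X j * Y j.+1 - Y j * X j.+1) = - \sum_(j < N) M j.
  have tel : \sum_(j < N) (X j.+1 * Y j.+1 - X j * Y j) = 0.
    rewrite -(big_mkord predT (fun j => X j.+1 * Y j.+1 - X j * Y j)).
    by rewrite telescope_sumr // YN Y0 !mulr0 subrr.
  apply/eqP; rewrite -subr_eq0 opprK -big_split /=; apply/eqP.
  by rewrite -[RHS]tel; apply: eq_bigr => j _; rewrite /M; ring.
rewrite normrN; apply: (le_trans (ler_norm_sum _ _ _)).
set S := \sum_(j < N) _.
have bnd : 2 * c * s * S <= N%:R * c ^+ 2 * h ^+ 2.
  rewrite /S mulr_sumr -subr_ge0; apply: (le_trans W).
  have -> : N%:R * c ^+ 2 * h ^+ 2 = \sum_(j < N) c ^+ 2 * h ^+ 2.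
    by rewrite sumr_const card_ord -mulr_natl; ring.
  rewrite -sumrB; apply: ler_sum => j _.
  rewrite -(step j) // ct /M normrM.
  set y := Y j; set y' := Y j.+1; set d := X j.+1 - X j.
  have := sqr_ge0 (s * `|y + y'| - c * `|d|).
  have := real_normK (num_real d); have := real_normK (num_real (y + y')).
  have : 2 * y * y' * (c ^+ 2 + s ^+ 2) = 2 * y * y' by rewrite c2s2 mulr1.
  nra.
have S0 : 0 <= S by apply: sumr_ge0 => j _; exact: normr_ge0.
rewrite ler_pdivlMr ?pi_gt0 //.
have -> : pi = N%:R * t by rewrite mulrC mulfVK ?lt0r_neq0.
rewrite mulrCA expr2 -!mulrA ler_pM2l // -(ler_pM2l c0).
have : 2 * s * S <= N%:R * c * h ^+ 2.
  rewrite -(ler_pM2l c0); move: bnd; lra.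
have : t / 2 * c * S <= s * S by rewrite ler_wpM2r.
lra.
Qed.

Definition crs (R : realType) (a b : R * R) : R := a.1 * b.2 - a.2 * b.1.

(** The vector [(n1, n2)] is parallel to [(a, b)]. A zero vector, the chord of a closed path, has no
    direction, and any axis serves. *)
Lemma unit_normal (R : realType) (a b : R) :
  exists n1 n2 : R, n1 ^+ 2 + n2 ^+ 2 = 1 /\ n1 * b - n2 * a = 0.
Proof.
have [ab|ab] := eqVneq (a ^+ 2 + b ^+ 2) 0.
  have [a0 b0] : a = 0 /\ b = 0.
    by move/eqP: ab; rewrite paddr_eq0 ?sqr_ge0 // !sqrf_eq0 => /andP[/eqP ? /eqP].
  by exists 1, 0; rewrite a0 b0; split; ring.
have s0 : Num.sqrt (a ^+ 2 + b ^+ 2) != 0.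
  by rewrite sqrtr_eq0 -ltNge lt_def ab addr_ge0 ?sqr_ge0.
have sE : Num.sqrt (a ^+ 2 + b ^+ 2) ^+ 2 = a ^+ 2 + b ^+ 2.
  by rewrite sqr_sqrtr // addr_ge0 ?sqr_ge0.
exists (a / Num.sqrt (a ^+ 2 + b ^+ 2)), (b / Num.sqrt (a ^+ 2 + b ^+ 2)).
split; last by field.
by rewrite !expr_div_n -mulrDl sE mulfV.
Qed.

(** A rotation makes the chord parallel to the x-axis and preserves [crs]; subtracting the term of
    the chord makes the sum independent of the origin. *)
Lemma path_area_le (R : realType) (N : nat) (r : nat -> R * R) (h : R) :
  (1 < N)%N ->
  (forall j, (j < N)%N ->
    ((r j.+1).1 - (r j).1) ^+ 2 + ((r j.+1).2 - (r j).2) ^+ 2 = h ^+ 2) ->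
  `|\sum_(j < N) crs (r j) (r j.+1) - crs (r 0%N) (r N)|
    <= N%:R ^+ 2 * h ^+ 2 / pi.
Proof.
move=> N1 step.
have [n1 [n2 [n12 nV]]] := unit_normal ((r N).1 - (r 0%N).1) ((r N).2 - (r 0%N).2).
pose X j := n1 * ((r j).1 - (r 0%N).1) + n2 * ((r j).2 - (r 0%N).2).
pose Y j := n1 * ((r j).2 - (r 0%N).2) - n2 * ((r j).1 - (r 0%N).1).
have Y0 : Y 0%N = 0 by rewrite /Y !subrr !mulr0 subrr.
have stepXY j : (j < N)%N ->
    (X j.+1 - X j) ^+ 2 + (Y j.+1 - Y j) ^+ 2 = h ^+ 2.
  by move=> jN; rewrite -(step j jN) -[RHS]mul1r -n12 /X /Y; ring.
have := chord_area_le N1 Y0 nV stepXY; congr (`| _ | <= _).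
have -> : crs (r 0%N) (r N) = \sum_(j < N) (crs (r 0%N) (r j.+1) - crs (r 0%N) (r j)).
  rewrite -(big_mkord predT (fun j => crs (r 0%N) (r j.+1) - crs (r 0%N) (r j))).
  by rewrite telescope_sumr // /crs; ring.
rewrite -sumrB; apply: eq_bigr => j _.
by rewrite -[RHS]mul1r -n12 /X /Y /crs; ring.
Qed.

(* Cutting at half of the perimeter, which is a vertex after halving every
   edge, reduces to two arcs with both ends on one line. *)
Lemma polygon_area_le (R : realType) (k : nat) (q : nat -> R * R) :
  (1 < k)%N -> q k = q 0%N ->
  (forall j, (j < k)%N ->
    ((q j.+1).1 - (q j).1) ^+ 2 + ((q j.+1).2 - (q j).2) ^+ 2 = 1) ->
  `|\sum_(j < k) crs (q j) (q j.+1)| <= k%:R ^+ 2 / (2 * pi).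
Proof.
move=> k1 qk step.
(* Even indices give the vertices, since there [j./2] and [uphalf j] agree; odd ones give the
   midpoints of the edges. *)
pose g j := (((q j./2).1 + (q (uphalf j)).1) / 2, ((q j./2).2 + (q (uphalf j)).2) / 2).
have g2 j : g j.*2 = q j.
  by rewrite /g doubleK uphalf_double; case: (q j) => a b /=; congr (_, _); field.
have g21 j : g j.*2.+1 = (((q j).1 + (q j.+1).1) / 2, ((q j).2 + (q j.+1).2) / 2).
  by rewrite /g /= uphalf_double doubleK.
have gstep j : (j < k.*2)%N ->
    ((g j.+1).1 - (g j).1) ^+ 2 + ((g j.+1).2 - (g j).2) ^+ 2 = (1 / 2) ^+ 2 :> R.
  rewrite -(odd_double_half j); case: (odd j) => jk.
    rewrite add1n -doubleS g2 g21 /=.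
    have jk' : (j./2 < k)%N by rewrite -ltn_double; apply: ltn_trans jk; rewrite add1n.
    by have := step _ jk'; lra.
  rewrite add0n g2 g21 /=.
  have jk' : (j./2 < k)%N by rewrite -ltn_double.
  by have := step _ jk'; lra.
have sumE : \sum_(j < k) crs (q j) (q j.+1) = \sum_(j < k.*2) crs (g j) (g j.+1).
  elim: k {k1 qk step gstep} => [|k IH]; first by rewrite !big_ord0.
  rewrite doubleS !big_ord_recr /= -IH -addrA; congr (_ + _).
  by rewrite -doubleS !g2 g21 /crs /=; field.
have split2 : \sum_(j < k.*2) crs (g j) (g j.+1) =
    (\sum_(j < k) crs (g j) (g j.+1) - crs (g 0%N) (g k)) +
    (\sum_(j < k) crs (g (k + j)%N) (g (k + j).+1) - crs (g (k + 0)%N) (g (k + k)%N)).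
  rewrite -addnn big_split_ord /= addn0 -/(g 0%N).
  have -> : g (k + k)%N = g 0%N by rewrite addnn g2 qk -[0%N]/(0.*2) g2.
  rewrite /crs; ring.
rewrite sumE split2; apply: (le_trans (ler_normD _ _)).
have halve (P : R) : 0 < P -> k%:R ^+ 2 / (2 * P) =
    k%:R ^+ 2 * (1 / 2) ^+ 2 / P + k%:R ^+ 2 * (1 / 2) ^+ 2 / P.
  by move=> P0; field; rewrite lt0r_neq0.
rewrite halve ?pi_gt0 //; apply: lerD.
  by apply: path_area_le => // j jk; apply: gstep; rewrite -addnn ltn_addr.
have := @path_area_le _ k (fun j => g (k + j)%N) (1 / 2) k1; rewrite /=.
under eq_bigr do rewrite addnS.
apply=> j jk; rewrite addnS; apply: gstep.
by rewrite -addnn ltn_add2l.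
Qed.

Lemma sum_porbit (R : realType) (D : finType) (s : {perm D}) (F : D -> R) (x : D) :
  \sum_(d in porbit s x) F d = \sum_(i < #|porbit s x|) F (iter i s x).
Proof.
rewrite (eq_bigl (mem (traject s x #|porbit s x|))); last first.
  by move=> d; rewrite porbit_traject.
rewrite -big_uniq ?uniq_traject_porbit //= (big_nth x) size_traject big_mkord.
by apply: eq_bigr => i _; rewrite nth_traject.
Qed.

(** The boundary may fall apart into several closed walks, the cycles of [s]. The bound survives
    because the sum of the squares of their lengths is at most the square of the sum. *)
Lemma perm_area_le (R : realType) (D : finType) (s : {perm D}) (A : {set D})
    (q : D -> R * R) :
  (forall d, d \in A -> s d \in A) ->
  (forall d, d \in A ->
    ((q (s d)).1 - (q d).1) ^+ 2 + ((q (s d)).2 - (q d).2) ^+ 2 = 1) ->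
  `|\sum_(d in A) crs (q d) (q (s d))| <= #|A|%:R ^+ 2 / (2 * pi).
Proof.
move=> sA step.
have it i x : x \in A -> iter i s x \in A by move=> xA; elim: i => //= i /sA.
have orbA x : x \in A -> porbit s x \subset A.
  move=> xA; apply/subsetP => d; rewrite porbit_traject => /trajectP[i _ ->].
  exact: it.
have fib (F : D -> R) : \sum_(d in A) F d =
    \sum_(B in porbit s @: A) \sum_(d in B) F d.
  rewrite (partition_big_imset (porbit s)); apply: eq_bigr => B /imsetP[x xA ->].
  apply: eq_bigl => d; rewrite eq_porbit_mem porbit_sym; apply: andb_idl => dx.
  by apply: (subsetP (orbA _ xA)); rewrite porbit_sym.
have cardE : #|A|%:R = \sum_(B in porbit s @: A) #|B|%:R :> R.
  rewrite -sum1_card natr_sum fib; apply: eq_bigr => B _.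
  by rewrite -sum1_card natr_sum.
rewrite fib; apply: (le_trans (ler_norm_sum _ _ _)).
apply: (@le_trans _ _ (\sum_(B in porbit s @: A) #|B|%:R ^+ 2 / (2 * pi))).
  apply: ler_sum => B /imsetP[x xA ->].
  rewrite sum_porbit.
  have -> : \sum_(i < #|porbit s x|) crs (q (iter i s x)) (q (s (iter i s x))) =
     \sum_(i < #|porbit s x|) crs (q (iter i s x)) (q (iter i.+1 s x)) by [].
  apply: (@polygon_area_le _ #|porbit s x| (fun i => q (iter i s x))).
  (* A fixed point would be an edge of length 0, so every cycle has at least two sides. *)
  - rewrite ltnNge; apply/negP => p1.
    have sx : s x = x.
      rewrite -[RHS](iter_porbit s x); case: #|_| (card_porbit_neq0 s x) p1 => [|[|]] //.
    have := step x xA; rewrite sx !subrr expr0n /= addr0 => /esym/eqP.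
    by rewrite oner_eq0.
  - by rewrite iter_porbit.
  - by move=> j _; apply: step; apply: it.
rewrite -mulr_suml ler_wpM2r ?invr_ge0 ?mulr_ge0 ?pi_ge0 // cardE expr2 mulr_suml.
apply: ler_sum => B BA; rewrite expr2 ler_wpM2l ?ler0n //.
by rewrite (bigD1 B) //= lerDl sumr_ge0.
Qed.

(** * Angles *)

Lemma cos_eq1_inj (R : realType) (x : R) :
  - (2 * pi) < x < 2 * pi -> cos x = 1 -> x = 0.
Proof.
move=> /andP[x1 x2] cx.
have s0 : sin (x / 2) = 0.
  have : cos x = 1 - 2 * sin (x / 2) ^+ 2.
    by rewrite {1}(splitr x) cosD -!expr2 cos2sin2; ring.
  by rewrite cx => h; apply/eqP; rewrite -sqrf_eq0; apply/eqP; lra.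
have [x0|x0|//] := ltgtP x 0.
  have : 0 < sin (- (x / 2)) by apply: sin_gt0_pi; lra.
  by rewrite sinN s0 oppr0 ltxx.
have : 0 < sin (x / 2) by apply: sin_gt0_pi; lra.
by rewrite s0 ltxx.
Qed.

Definition dot (R : realType) (a b : R * R) : R := a.1 * b.1 + a.2 * b.2.

Definition norm2 (R : realType) (a : R * R) : R := Num.sqrt (dot a a).

Definition arg (R : realType) (a : R * R) : R :=
  if 0 <= a.2 then acos (a.1 / norm2 a) else 2 * pi - acos (a.1 / norm2 a).

Lemma dot_ge0 (R : realType) (a : R * R) : 0 <= dot a a.
Proof. by rewrite /dot -!expr2 addr_ge0 ?sqr_ge0. Qed.

Lemma dot_eq0 (R : realType) (a : R * R) : (dot a a == 0) = (a == (0, 0)).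
Proof.
by case: a => x y; rewrite /dot -!expr2 paddr_eq0 ?sqr_ge0 // !sqrf_eq0.
Qed.

Lemma norm2_sqr (R : realType) (a : R * R) : norm2 a ^+ 2 = dot a a.
Proof. by rewrite sqr_sqrtr // dot_ge0. Qed.

Lemma norm2_gt0 (R : realType) (a : R * R) : (0 < norm2 a) = (a != (0, 0)).
Proof. by rewrite sqrtr_gt0 lt_def dot_ge0 andbT dot_eq0. Qed.

Lemma argP (R : realType) (a : R * R) : a != (0, 0) ->
  [/\ 0 <= arg a < 2 * pi, a.1 = norm2 a * cos (arg a)
    & a.2 = norm2 a * sin (arg a)].
Proof.
rewrite -norm2_gt0 => n0.
have nE := norm2_sqr a; rewrite /dot -!expr2 in nE.
set x := a.1 / norm2 a.
have aE : a.1 = norm2 a * x by rewrite mulrC mulfVK ?lt0r_neq0.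
have x2 : x ^+ 2 <= 1.
  by rewrite expr_div_n ler_pdivrMr ?exprn_gt0 // mul1r nE lerDl sqr_ge0.
have xI : -1 <= x <= 1 by apply/andP; split; nra.
have a2 : a.2 ^+ 2 = (norm2 a * Num.sqrt (1 - x ^+ 2)) ^+ 2.
  have sE : Num.sqrt (1 - x ^+ 2) ^+ 2 = 1 - x ^+ 2 by rewrite sqr_sqrtr ?subr_ge0.
  by rewrite exprMn sE mulrBr mulr1 -exprMn -aE nE; ring.
have s0 : 0 <= norm2 a * Num.sqrt (1 - x ^+ 2) by rewrite mulr_ge0 ?sqrtr_ge0 // ltW.
rewrite /arg -/x; case: ifPn => [a0|]; last rewrite -ltNge => a0.
  split; [|by rewrite acosK ?in_itv|].
    rewrite acos_ge0 //=; apply: le_lt_trans (acos_lepi xI) _.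
    by have := @pi_gt0 R; lra.
  by rewrite sin_acos //; apply/eqP; rewrite -(@eqrXn2 _ 2) // a2.
have E2 : 2 * pi - acos x = - acos x + pi *+ 2 :> R by rewrite -mulr_natl; ring.
split; [|by rewrite E2 cosD2pi cosN acosK ?in_itv|].
  have := acos_lepi xI; have : 0 < acos x; last by have := @pi_gt0 R; lra.
  apply: acos_gt0; rewrite (andP xI).1 lt_neqAle (andP xI).2 andbT /=.
  apply: contraTneq a0 => x1; move: a2; rewrite x1 expr1n subrr sqrtr0 mulr0 expr0n /=.
  by move/eqP; rewrite sqrf_eq0 => /eqP ->; rewrite ltxx.
rewrite E2 sinD2pi sinN sin_acos // mulrN.
by apply/eqP; rewrite -eqr_oppLR -(@eqrXn2 _ 2) ?sqrrN ?a2 // oppr_ge0 ltW.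
Qed.

(** The counterclockwise turn from [x] to [y]. Its value at [x = y] is [2 * pi] and not 0, so that a
    single edge at a vertex spans a full angle. *)
Definition cang (R : realType) (x y : R) : R :=
  if x < y then y - x else y - x + 2 * pi.

Lemma cang_bnd (R : realType) (x y : R) :
  0 <= x < 2 * pi -> 0 <= y < 2 * pi -> 0 < cang x y <= 2 * pi.
Proof. by move=> /andP[? ?] /andP[? ?]; rewrite /cang; case: (ltP x y) => ?; lra. Qed.

Lemma cang_inj (R : realType) (x y z : R) :
  0 <= x < 2 * pi -> 0 <= y < 2 * pi -> 0 <= z < 2 * pi ->
  cang x y = cang x z -> y = z.
Proof.
move=> /andP[? ?] /andP[? ?] /andP[? ?]; rewrite /cang.
by case: (ltP x y) => ?; case: (ltP x z) => ?; lra.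
Qed.

Lemma cangxx (R : realType) (x : R) : cang x x = 2 * pi.
Proof. by rewrite /cang ltxx subrr add0r. Qed.

Lemma cang_split (R : realType) (x y z : R) :
  0 <= x < 2 * pi -> 0 <= y < 2 * pi -> 0 <= z < 2 * pi ->
  cang x y < cang x z -> cang x z = cang x y + cang y z.
Proof.
move=> /andP[? ?] /andP[? ?] /andP[? ?]; rewrite /cang.
by case: (ltP x y) => ?; case: (ltP x z) => ?; case: (ltP y z) => ?; lra.
Qed.

Lemma cang_add (R : realType) (x y z : R) :
  0 <= x < 2 * pi -> 0 <= y < 2 * pi -> 0 <= z < 2 * pi ->
  cang x y + cang y z < 2 * pi -> cang x z = cang x y + cang y z.
Proof.
move=> /andP[? ?] /andP[? ?] /andP[? ?]; rewrite /cang.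
by case: (ltP x y) => ?; case: (ltP x z) => ?; case: (ltP y z) => ?; lra.
Qed.

Definition ang (R : realType) (a b : R * R) : R := cang (arg a) (arg b).

Lemma ang_bnd (R : realType) (a b : R * R) :
  a != (0, 0) -> b != (0, 0) -> 0 < ang a b <= 2 * pi.
Proof. by move=> /argP[? _ _] /argP[? _ _]; exact: cang_bnd. Qed.

Lemma ang_cos_sin (R : realType) (a b : R * R) :
  a != (0, 0) -> b != (0, 0) ->
  norm2 a * norm2 b * cos (ang a b) = dot a b /\ norm2 a * norm2 b * sin (ang a b) = crs a b.
Proof.
move=> /argP[_ a1 a2] /argP[_ b1 b2].
have [-> ->] : (cos (ang a b) = cos (arg b - arg a)) /\
    (sin (ang a b) = sin (arg b - arg a)).
  by rewrite /ang /cang; case: (ltP (arg a)) => _ //; rewrite mulr_natl cosD2pi sinD2pi.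
rewrite cosB sinB /dot /crs a1 a2 b1 b2; split; ring.
Qed.

Lemma ang_uniq (R : realType) (a b : R * R) (th : R) :
  a != (0, 0) -> b != (0, 0) -> 0 < th <= 2 * pi ->
  norm2 a * norm2 b * cos th = dot a b ->
  norm2 a * norm2 b * sin th = crs a b -> ang a b = th.
Proof.
move=> a0 b0 thb c s; have [c' s'] := ang_cos_sin a0 b0.
have n0 : norm2 a * norm2 b != 0 by rewrite lt0r_neq0 // mulr_gt0 ?norm2_gt0.
have ec : cos (ang a b) = cos th by apply: (mulfI n0); rewrite c c'.
have es : sin (ang a b) = sin th by apply: (mulfI n0); rewrite s s'.
apply/eqP; rewrite -subr_eq0; apply/eqP; apply: cos_eq1_inj.
  by have := ang_bnd a0 b0; lra.
by rewrite cosB ec es -!expr2 cos2Dsin2.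
Qed.

Lemma ang_lt_pi (R : realType) (a b : R * R) :
  a != (0, 0) -> b != (0, 0) -> (ang a b < pi) = (0 < crs a b).
Proof.
move=> a0 b0; have [_ <-] := ang_cos_sin a0 b0; have /andP[an0 an2] := ang_bnd a0 b0.
rewrite pmulr_rgt0 ?mulr_gt0 ?norm2_gt0 //; case: ltP => anpi.
  by rewrite sin_gt0_pi ?an0.
have -> : ang a b = ang a b - pi + pi by ring.
rewrite sinDpi oppr_gt0 ltNge sin_ge0_pi //; lra.
Qed.

Lemma ang_lt (R : realType) (a x b : R * R) :
  a != (0, 0) -> x != (0, 0) -> b != (0, 0) -> 0 < crs a b ->
  (ang a x < ang a b) = (0 < crs a x) && (0 < crs x b).
Proof.
move=> a0 x0 b0; rewrite -!ang_lt_pi // => ab.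
have [A _ _] := argP a0; have [X _ _] := argP x0; have [B _ _] := argP b0.
have xb := ang_bnd x0 b0.
have ax := ang_bnd a0 x0.
apply/idP/andP => [axb|[ax1 xb1]].
  have := cang_split A X B axb; rewrite -!/(ang _ _); lra.
have := @cang_add _ (arg a) (arg x) (arg b) A X B; rewrite -!/(ang _ _); lra.
Qed.

Lemma ang_opp (R : realType) (a b : R * R) :
  a != (0, 0) -> b != (0, 0) -> ang (- a.1, - a.2) (- b.1, - b.2) = ang a b.
Proof.
move=> a0 b0; have [c s] := ang_cos_sin a0 b0.
have nN (z : R * R) : norm2 (- z.1, - z.2) = norm2 z.
  by rewrite /norm2 /dot /=; congr Num.sqrt; ring.
have N0 (z : R * R) : z != (0, 0) -> (- z.1, - z.2) != (0, 0) by rewrite -!norm2_gt0 nN.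
apply: ang_uniq; rewrite ?N0 ?ang_bnd // !nN ?c ?s /dot /crs /=; ring.
Qed.

Lemma ang_xN (R : realType) (a : R * R) : a != (0, 0) -> ang a (- a.1, - a.2) = pi.
Proof.
move=> a0.
have nN : norm2 (- a.1, - a.2) = norm2 a.
  by rewrite /norm2 /dot /=; congr Num.sqrt; ring.
apply: ang_uniq; rewrite -?norm2_gt0 ?nN ?norm2_gt0 //.
- by have := @pi_gt0 R; lra.
- by rewrite cospi -expr2 norm2_sqr /dot /=; ring.
- by rewrite sinpi /crs /=; ring.
Qed.

Definition vec (R : realType) (a b : R * R) : R * R := (b.1 - a.1, b.2 - a.2).

(** Reversing both directions turns the angle at [c] into the turn from [ac] to [bc]. The three
    angles are then consecutive turns, from [ab] through [ac] and [bc] to [ba], and together make a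
    half turn. *)
Lemma triangle_ang (R : realType) (a b c : R * R) :
  0 < crs (vec a b) (vec a c) ->
  ang (vec a b) (vec a c) + ang (vec b c) (vec b a) + ang (vec c a) (vec c b) = pi.
Proof.
move=> abc.
have nz (x y : R * R) : 0 < crs x y -> x != (0, 0) /\ y != (0, 0).
  by move=> xy; split; apply: contraTneq xy => ->; rewrite /crs /= ?mul0r ?mulr0 subrr ltxx.
have bca : 0 < crs (vec b c) (vec b a) by move: abc; rewrite /crs /vec /=; lra.
have cab : 0 < crs (vec c a) (vec c b) by move: abc; rewrite /crs /vec /=; lra.
have [ab0 ac0] := nz _ _ abc; have [bc0 ba0] := nz _ _ bca; have [ca0 cb0] := nz _ _ cab.
have E (x y : R * R) : vec x y = (- (vec y x).1, - (vec y x).2).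
  by rewrite /vec /=; congr (_, _); ring.
have -> : ang (vec c a) (vec c b) = ang (vec a c) (vec b c).
  by rewrite (E c a) (E c b) ang_opp.
have pi1 := abc; rewrite -ang_lt_pi // in pi1.
have pi2 := bca; rewrite -ang_lt_pi // in pi2.
have pi3 : ang (vec a c) (vec b c) < pi.
  by rewrite ang_lt_pi //; move: abc; rewrite /crs /vec /=; lra.
have [A _ _] := argP ab0; have [B _ _] := argP ac0.
have [C _ _] := argP bc0; have [D _ _] := argP ba0.
have pi4 : ang (vec a b) (vec b c) < pi.
  by rewrite ang_lt_pi //; move: abc; rewrite /crs /vec /=; lra.
have e1 : ang (vec a b) (vec b c) = ang (vec a b) (vec a c) + ang (vec a c) (vec b c).
  by apply: cang_add => //; rewrite -!/(ang _ _); lra.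
have e2 : ang (vec a b) (vec b a) = ang (vec a b) (vec b c) + ang (vec b c) (vec b a).
  by apply: cang_add => //; rewrite -!/(ang _ _); lra.
have := ang_xN ab0; rewrite -E; lra.
Qed.

(** * Cyclic order of directions *)

(** The next direction counterclockwise. Since [cang x x] is the largest possible value, [w] follows
    itself only if it is the sole direction. *)
Definition nxt (R : realType) (T : finType) (al : T -> R) (N : {set T}) (w : T) : T :=
  [arg min_(u < w in N) cang (al w) (al u)]%O.

Definition gap (R : realType) (T : finType) (al : T -> R) (N : {set T}) (w : T) : R :=
  cang (al w) (al (nxt al N w)).

Definition directions (R : realType) (T : finType) (al : T -> R) (N : {set T}) : Prop :=
  (forall u, u \in N -> 0 <= al u < 2 * pi) /\ {in N &, injective al}.

Lemma directionsS (R : realType) (T : finType) (al : T -> R) (N N' : {set T}) :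
  N' \subset N -> directions al N -> directions al N'.
Proof.
move=> /subsetP s [b i]; split => [u /s /b //|u v /s uN /s vN]; exact: i.
Qed.

Lemma nxtP (R : realType) (T : finType) (al : T -> R) (N : {set T}) (w : T) :
  w \in N ->
  nxt al N w \in N /\ (forall u, u \in N -> gap al N w <= cang (al w) (al u)).
Proof. by move=> wN; rewrite /gap /nxt; case: arg_minP. Qed.

Lemma nxt_uniq (R : realType) (T : finType) (al : T -> R) (N : {set T}) (w u : T) :
  directions al N -> w \in N -> u \in N ->
  (forall x, x \in N -> cang (al w) (al u) <= cang (al w) (al x)) -> nxt al N w = u.
Proof.
move=> [b i] wN uN um; have [nN nm] := nxtP al wN.
apply: i => //; apply: (@cang_inj _ (al w)); rewrite ?b //.
by apply/eqP; rewrite eq_le -/(gap al N w) nm // um.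
Qed.

Lemma gap_bnd (R : realType) (T : finType) (al : T -> R) (N : {set T}) (w : T) :
  directions al N -> w \in N -> 0 < gap al N w <= 2 * pi.
Proof. by move=> [b _] wN; have [? _] := nxtP al wN; rewrite cang_bnd ?b. Qed.

Lemma cang_neq (R : realType) (T : finType) (al : T -> R) (N : {set T}) (w x : T) :
  directions al N -> w \in N -> x \in N -> w != x -> cang (al w) (al x) < 2 * pi.
Proof.
move=> [b i] wN xN wx.
have /andP[_ c2] := cang_bnd (b _ wN) (b _ xN).
rewrite lt_neqAle c2 andbT; apply: contra wx => /eqP e.
by apply/eqP/i => //; apply: (@cang_inj _ (al w)); rewrite ?b // cangxx.
Qed.

(** Of two directions with a common successor, one would lie on the turn from the other to that
    successor. *)
Lemma nxt_inj (R : realType) (T : finType) (al : T -> R) (N : {set T}) :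
  directions al N -> {in N &, injective (nxt al N)}.
Proof.
move=> d w1 w2 N1 N2 e; apply/eqP; apply: contraT => ne.
have [b i] := d.
have [n1 m1] := nxtP al N1; have [n2 m2] := nxtP al N2.
have {m1} := m1 _ N2; have {m2} := m2 _ N1.
have := cang_neq d N1 N2 ne; have := cang_neq d N2 N1; rewrite eq_sym => /(_ ne).
have : al w1 != al w2 by apply: contra ne => /eqP ?; apply/eqP; exact: i.
rewrite /gap e; move: (b _ N1) (b _ N2) (b _ n2).
move: (al w1) (al w2) (al (nxt al N w2)) => x y z /andP[? ?] /andP[? ?] /andP[? ?].
rewrite /cang; have [?|?|//] := ltgtP x y => _;
  by case: (ltP x z) => ?; case: (ltP y z) => ?; lra.
Qed.

Lemma nxt_neq (R : realType) (T : finType) (al : T -> R) (N : {set T}) (w x : T) :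
  directions al N -> w \in N -> x \in N -> x != w -> nxt al N w != w.
Proof.
move=> d wN xN xw; have [_ /(_ _ xN)] := nxtP al wN.
rewrite eq_sym in xw; have := cang_neq d wN xN xw.
by move=> h1 h2; apply: contraTneq (le_lt_trans h2 h1) => e; rewrite /gap e cangxx ltxx.
Qed.

Lemma nxt_surj (R : realType) (T : finType) (al : T -> R) (N : {set T}) (b : T) :
  directions al N -> b \in N -> exists2 a, a \in N & nxt al N a = b.
Proof.
move=> d bN.
have sub : nxt al N @: N \subset N.
  by apply/subsetP => x /imsetP[w wN ->]; exact: (nxtP al wN).1.
have : b \in nxt al N @: N.
  suff -> : nxt al N @: N = N by [].
  by apply/eqP; rewrite eqEcard sub (card_in_imset (nxt_inj d)) leqnn.
by case/imsetP => a aN ->; exists a.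
Qed.

Lemma nxtD1_neq (R : realType) (T : finType) (al : T -> R) (N : {set T}) (a b w : T) :
  directions al N -> a \in N -> nxt al N a = b -> w \in N -> w != b -> w != a ->
  nxt al (N :\ b) w = nxt al N w.
Proof.
move=> d aN ab wN wb wa; have [nN nm] := nxtP al wN.
apply: nxt_uniq; rewrite ?in_setD1 ?wb ?nN ?andbT //.
- by apply: directionsS d; exact: subD1set.
- by apply: contra wa => /eqP e; apply/eqP/(nxt_inj d) => //; rewrite e.
- by move=> x; rewrite in_setD1 => /andP[_ /nm].
Qed.

Lemma nxtD1 (R : realType) (T : finType) (al : T -> R) (N : {set T}) (a b : T) :
  directions al N -> a \in N -> nxt al N a = b -> a != b ->
  nxt al (N :\ b) a = nxt al N b /\ gap al (N :\ b) a = gap al N a + gap al N b.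
Proof.
move=> d aN ab neq; have [bd i] := d.
have [nN nm] := nxtP al aN; rewrite ab in nN.
have [nbN nbm] := nxtP al nN.
have spl x : x \in N -> x != b ->
    cang (al a) (al x) = gap al N a + cang (al b) (al x).
  move=> xN xb; rewrite /gap ab; apply: cang_split; rewrite ?bd //.
  rewrite lt_neqAle -{2}ab nm // andbT; apply: contra xb => /eqP.
  by move/(cang_inj (bd _ aN) (bd _ nN) (bd _ xN)) => e; apply/eqP; exact: i.
have nbb : nxt al N b != b by exact: (nxt_neq d nN aN).
have e : nxt al (N :\ b) a = nxt al N b.
  apply: nxt_uniq; rewrite ?in_setD1 ?neq ?nbN ?nbb //.
    by apply: directionsS d; exact: subD1set.
  move=> x; rewrite in_setD1 => /andP[xb xN].
  by rewrite !spl // lerD2l nbm.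
by split => //; rewrite {1}/gap e spl.
Qed.

(** Deleting a direction merges its gap with the preceding one, so the sum persists down to a single
    direction, whose gap is a full turn. *)
Lemma sum_gap (R : realType) (T : finType) (al : T -> R) (N : {set T}) :
  directions al N -> N != finset.set0 -> \sum_(w in N) gap al N w = 2 * pi.
Proof.
move eN : #|N| => n; elim: n N eN => [|n IH] N eN d N0.
  by move/eqP: eN N0; rewrite cards_eq0 => ->.
have [b bN] := set0Pn _ N0.
have [a aN ab] := nxt_surj d bN.
have [eab|neq] := eqVneq a b.
  have N1 : N = finset.set1 b.
    apply/eqP; rewrite eqEsubset finset.sub1set bN andbT; apply/subsetP => x xN.
    rewrite inE; apply: contraT => xb.
    by have := nxt_neq d bN xN xb; rewrite -{1}eab ab eqxx.
  have bb : nxt al N b = b by rewrite -{1}eab.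
  by rewrite {1}N1 big_set1 /gap bb cangxx.
have [nE gE] := nxtD1 d aN ab neq.
have aD : a \in N :\ b by rewrite in_setD1 neq.
rewrite (big_setD1 b) //= (big_setD1 a) //= addrA [_ + gap al N a]addrC -gE.
rewrite -(IH (N :\ b)); first rewrite [RHS](big_setD1 a) //=.
- congr (_ + _); apply: eq_bigr => w; rewrite !in_setD1 => /and3P[wa wb wN].
  by rewrite /gap (nxtD1_neq d aN ab).
- by have := cardsD1 b N; rewrite bN eN => -[].
- by apply: directionsS d; exact: subD1set.
- by apply/set0Pn; exists a.
Qed.

(** * Noncrossing segments *)

Definition comb (R : realType) (t : R) (a b : R * R) : R * R :=
  ((1 - t) * a.1 + t * b.1, (1 - t) * a.2 + t * b.2).

Definition compatible (R : realType) (T : finType) (p : T -> R * R)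
    (D : {set T * T}) (x y : T) : Prop :=
  forall (a b : T) (z : R * R), (a, b) \in D -> [set a; b] != [set x; y] ->
    on_segment (p a) (p b) z -> on_segment (p x) (p y) z ->
    exists c : T, [/\ c \in [set a; b], c \in [set x; y] & z = p c].

(** Compatibility compares edges only. It is [plane_cover] that keeps a vertex out of the interior
    of an edge: the vertex is an end of some other edge, which would meet the first one there. *)
Record plane (R : realType) (T : finType) (p : T -> R * R)
    (D : {set T * T}) : Prop := Plane {
  plane_sym : forall x y, (x, y) \in D -> (y, x) \in D;
  plane_irr : forall x, (x, x) \notin D;
  plane_cover : forall x, exists y, (x, y) \in D;
  plane_compatible : forall x y, (x, y) \in D -> compatible p D x y
}.

Definition saturated (R : realType) (T : finType) (p : T -> R * R)
    (D : {set T * T}) : Prop :=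
  forall x y, x != y -> compatible p D x y -> (x, y) \in D.

Lemma compatible_affine (R : realType) (T : finType) (p : T -> R * R)
    (f : R * R -> R * R) (D : {set T * T}) (x y : T) :
  injective f -> (forall t a b, f (comb t a b) = comb t (f a) (f b)) ->
  compatible (fun v => f (p v)) D x y <-> compatible p D x y.
Proof.
move=> fi fc; split => h a b z abD ne [t [t01 ->]].
  move=> [t' [t'01 zE]].
  have {}zE : comb t (p a) (p b) = comb t' (p x) (p y) by [].
  have [||c [ca cx]] := h a b (f (comb t (p a) (p b))) abD ne.
  - by exists t; rewrite fc.
  - by exists t'; rewrite zE fc.
  - by move=> /fi zc; exists c.
move=> [t' [t'01]]; rewrite -!/(comb _ _ _) -!fc => /fi e.
have [||c [ca cx zc]] := h a b (comb t (p a) (p b)) abD ne.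
- by exists t.
- by exists t'.
- by exists c; split => //; rewrite zc.
Qed.

Lemma plane_affine (R : realType) (T : finType) (p : T -> R * R)
    (f : R * R -> R * R) (D : {set T * T}) :
  injective f -> (forall t a b, f (comb t a b) = comb t (f a) (f b)) ->
  plane p D -> plane (fun v => f (p v)) D.
Proof.
move=> fi fc [s i c h]; split=> // x y /h; by move/(compatible_affine p D x y fi fc).
Qed.

Lemma saturated_affine (R : realType) (T : finType) (p : T -> R * R)
    (f : R * R -> R * R) (D : {set T * T}) :
  injective f -> (forall t a b, f (comb t a b) = comb t (f a) (f b)) ->
  saturated p D -> saturated (fun v => f (p v)) D.
Proof.
move=> fi fc s x y xy /(compatible_affine p D x y fi fc); exact: s.
Qed.

Lemma plane_vertex (R : realType) (T : finType) (p : T -> R * R)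
    (D : {set T * T}) (a b x : T) :
  injective p -> plane p D -> (a, b) \in D -> on_segment (p a) (p b) (p x) ->
  x \in [set a; b].
Proof.
move=> pinj pl abD abx; have [y xyD] := plane_cover pl x.
have [<-|ne] := eqVneq [set x; y] [set a; b]; first by rewrite !inE eqxx.
have [|c [_ cab /pinj -> //]] := plane_compatible pl abD xyD ne _ abx.
by exists 0; rewrite lexx ler01 subr0 !mul1r !mul0r !addr0; split => //; case: (p x).
Qed.

(** * Empty triangles in a saturated drawing *)

Definition swap (R : realType) (a : R * R) : R * R := (a.2, a.1).

Lemma swap_inj (R : realType) : injective (@swap R).
Proof. by move=> [a b] [c d] [-> ->]. Qed.

Lemma swap_comb (R : realType) (t : R) (a b : R * R) :
  swap (comb t a b) = comb t (swap a) (swap b).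
Proof. by []. Qed.

(** On the way from [z] to [c] the segment meets the y-axis between [v] and [u], at height [y2],
    hence in a common end. If that were [v], then [c = v] and [c'] would be a neighbour of [v] in
    the open quadrant; so it is [u], on the line [x + y = 1]. *)
Lemma pierce_left (R : realType) (T : finType) (p : T -> R * R)
    (D : {set T * T}) (v u c c' : T) (t : R) (z : R * R) :
  injective p -> plane p D -> p v = (0, 0) -> p u = (0, 1) -> (v, u) \in D ->
  (forall x, (v, x) \in D -> 0 < (p x).1 -> 0 < (p x).2 -> False) ->
  (c, c') \in D -> 0 <= t <= 1 -> z = comb t (p c) (p c') ->
  0 < z.1 -> 0 < z.2 -> z.1 + z.2 <= 1 ->
  (p c).1 + (p c).2 <= z.1 + z.2 ->
  (p c).1 <= 0 -> (p c).1 * z.2 <= (p c).2 * z.1 ->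
  c = u /\ z.1 + z.2 = 1.
Proof.
move=> pinj pl pv pu vuD emp ccD /andP[t0 t1] zE z1 z2 zs cs c1 c12.
have [zE1 zE2] : (z.1 = (1 - t) * (p c).1 + t * (p c').1) /\
    (z.2 = (1 - t) * (p c).2 + t * (p c').2) by rewrite zE.
have c'1 : 0 < t * (p c').1 by move: z1; rewrite zE1; nra.
have tp : 0 < t by rewrite lt_neqAle t0 andbT; apply: contraTneq c'1 => <-; rewrite mul0r ltxx.
have c'1p : 0 < (p c').1 by rewrite -(pmulr_rgt0 _ tp).
have d0 : 0 < z.1 - (p c).1 by lra.
have dn : z.1 - (p c).1 != 0 by rewrite lt0r_neq0.
pose y2 := ((p c).2 * z.1 - (p c).1 * z.2) / (z.1 - (p c).1).
have y20 : 0 <= y2 by apply: divr_ge0; [rewrite subr_ge0 | exact: ltW].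
have y21 : y2 <= 1 by rewrite ler_pdivrMr // mul1r; nra.
have onvu : on_segment (p v) (p u) (0, y2).
  exists y2; rewrite y20 y21 pv pu; split => //=; congr (_, _); ring.
have oncc : on_segment (p c) (p c') (0, y2).
  pose k := - (p c).1 / (z.1 - (p c).1).
  have k0 : 0 <= k by apply: divr_ge0; [rewrite oppr_ge0 | exact: ltW].
  have k1 : k <= 1 by rewrite ler_pdivrMr //; lra.
  exists (k * t); split; first by apply/andP; split; nra.
  congr (_, _).
    transitivity ((1 - k) * (p c).1 + k * z.1); first by rewrite /k; field.
    by rewrite zE1; ring.
  transitivity ((1 - k) * (p c).2 + k * z.2); first by rewrite /k /y2; field.
  by rewrite zE2; ring.
have ne : [set v; u] != [set c; c'].
  apply/eqP => e; have : c' \in [set v; u] by rewrite e !inE eqxx orbT.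
  by rewrite !inE => /orP[] /eqP e'; move: c'1p; rewrite e' ?pv ?pu /= ltxx.
have [q []] := plane_compatible pl ccD vuD ne onvu oncc.
rewrite !inE => /orP[] /eqP qE /orP[] /eqP qE'; move=> qp.
- case: (emp c'); rewrite -?qE ?qE' //.
  have cv : p c = (0, 0) by rewrite -qE' qE.
  by move: z2; rewrite zE2 cv /= mulr0 add0r pmulr_rgt0.
- by move: c'1p; rewrite -qE' qE pv /= ltxx.
- split; first by rewrite -qE' qE.
  by move: cs; rewrite -qE' qE pu /=; lra.
- by move: c'1p; rewrite -qE' qE pu /= ltxx.
Qed.

(** Take for [c] the end with the smaller coordinate sum. If it is outside the open quadrant, its
    side of the ray from [v] through [z] tells which axis the segment crosses; [swap] exchanges the
    two cases. *)
Lemma pierce (R : realType) (T : finType) (p : T -> R * R)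
    (D : {set T * T}) (v w u a b : T) (z : R * R) :
  injective p -> plane p D -> p v = (0, 0) -> p w = (1, 0) -> p u = (0, 1) ->
  (v, w) \in D -> (v, u) \in D ->
  (forall x, (v, x) \in D -> 0 < (p x).1 -> 0 < (p x).2 -> False) ->
  (a, b) \in D -> on_segment (p a) (p b) z ->
  0 < z.1 -> 0 < z.2 -> z.1 + z.2 <= 1 ->
  exists2 c, c \in [set a; b] &
    [/\ 0 < (p c).1, 0 < (p c).2 & (p c).1 + (p c).2 <= z.1 + z.2]
    \/ ((c == u) || (c == w)) /\ z.1 + z.2 = 1.
Proof.
move=> pinj pl pv pw pu vwD vuD emp abD abz z1 z2 zs.
have [c [c' [t [ccD cab t01 zE cs]]]] : exists c c' t,
    [/\ (c, c') \in D, c \in [set a; b], 0 <= t <= 1, z = comb t (p c) (p c')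
      & (p c).1 + (p c).2 <= z.1 + z.2].
  have [t [/andP[t0 t1] zE]] := abz.
  have [ab|ba] := leP ((p a).1 + (p a).2) ((p b).1 + (p b).2).
    exists a, b, t; rewrite abD t0 t1 !inE eqxx zE /=; split => //; nra.
  exists b, a, (1 - t); rewrite (plane_sym pl abD) subr_ge0 t1 !inE eqxx orbT zE /comb /=.
  split; [by []|by []|lra|by congr (_, _); ring|nra].
exists c => //.
have [c12|c21] := leP ((p c).1 * z.2) ((p c).2 * z.1).
  have [c1|c1] := leP (p c).1 0.
    right; have [-> ->] := pierce_left pinj pl pv pu vuD emp ccD t01 zE z1 z2 zs cs c1 c12.
    by rewrite eqxx.
  left; split => //; rewrite -(pmulr_lgt0 _ z1); apply: lt_le_trans c12.
  exact: mulr_gt0.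
have [c2|c2] := leP (p c).2 0; last first.
  left; split => //; rewrite -(pmulr_lgt0 _ z2); apply: lt_trans c21.
  exact: mulr_gt0.
have spinj : injective (fun x => swap (p x)) by move=> x y /swap_inj /pinj.
have spl := plane_affine (@swap_inj R) (@swap_comb R) pl.
right; have [||||||||||-> /= e] := @pierce_left _ _ (fun x => swap (p x)) D v w c c' t (swap z)
  spinj spl _ _ vwD _ ccD t01.
- by rewrite pv.
- by rewrite pw.
- by move=> x vx /= x1 x2; exact: (emp x).
- by rewrite zE swap_comb.
- exact: z2.
- exact: z1.
- by rewrite /= addrC.
- by rewrite /= addrC [leRHS]addrC.
- exact: c2.
- exact: ltW.
- by rewrite eqxx orbT addrC e.
Qed.

(** Among the vertices in the triangle let [m] minimize the coordinate sum. An edge crossing the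
    segment from [v] to [m] would by [pierce] have an end in the triangle with a smaller sum. So the
    segment is compatible, and saturation makes it an edge inside the empty sector. *)
Lemma std_triangle_empty (R : realType) (T : finType) (p : T -> R * R)
    (D : {set T * T}) (v w u x : T) :
  injective p -> plane p D -> saturated p D ->
  p v = (0, 0) -> p w = (1, 0) -> p u = (0, 1) ->
  (v, w) \in D -> (v, u) \in D ->
  (forall x, (v, x) \in D -> 0 < (p x).1 -> 0 < (p x).2 -> False) ->
  0 < (p x).1 -> 0 < (p x).2 -> (p x).1 + (p x).2 <= 1 -> False.
Proof.
move=> pinj pl sat pv pw pu vwD vuD emp x1 x2 xs.
pose B y := [&& 0 < (p y).1, 0 < (p y).2 & (p y).1 + (p y).2 <= 1].
have Bx : B x by rewrite /B x1 x2.
pose m := [arg min_(y < x | B y) ((p y).1 + (p y).2)]%O.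
have [/and3P[m1 m2 ms] mmin] : B m /\
    (forall y, B y -> (p m).1 + (p m).2 <= (p y).1 + (p y).2).
  by rewrite /m; case: arg_minP.
apply: (emp m) => //; apply: sat => [|a b z abD ne abz [t [/andP[t0 t1] zE]]].
  by apply: contraTneq m1 => <-; rewrite pv ltxx.
have zE1 : z.1 = t * (p m).1 by rewrite zE pv /= mulr0 add0r.
have zE2 : z.2 = t * (p m).2 by rewrite zE pv /= mulr0 add0r.
have [t00|tn0] := eqVneq t 0.
  have zv : z = p v by rewrite pv [z]surjective_pairing zE1 zE2 t00 !mul0r.
  exists v; rewrite !inE eqxx zv; split => //.
  by rewrite -in_set2; apply: (plane_vertex pinj pl abD); rewrite -zv.
have [t11|tn1] := eqVneq t 1.
  have zm : z = p m by rewrite [z]surjective_pairing zE1 zE2 t11 !mul1r -surjective_pairing.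
  exists m; rewrite !inE eqxx orbT zm; split => //.
  by rewrite -in_set2; apply: (plane_vertex pinj pl abD); rewrite -zm.
have tp : 0 < t by rewrite lt_neqAle eq_sym tn0.
have tl1 : t < 1 by rewrite lt_neqAle tn1.
have zlt : z.1 + z.2 < (p m).1 + (p m).2.
  by rewrite zE1 zE2 -mulrDr gtr_pMl // addr_gt0.
have [|||c _ [[c1 c2 cs]|[_ e]]] := pierce pinj pl pv pw pu vwD vuD emp abD abz.
- by rewrite zE1 mulr_gt0.
- by rewrite zE2 mulr_gt0.
- exact: ltW (lt_le_trans zlt ms).
- have : B c by rewrite /B c1 c2 (le_trans cs) // ltW // (lt_le_trans zlt).
  move/mmin; rewrite leNgt => /negP[]; exact: le_lt_trans zlt.
- by move: (lt_le_trans zlt ms); rewrite e ltxx.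
Qed.

(** The edge runs along the line [x + y = 1], and as the triangle is empty it cannot end before [w].
    So [w] lies on it and is one of its ends. *)
Lemma std_no_tail (R : realType) (T : finType) (p : T -> R * R)
    (D : {set T * T}) (u w c : T) (t : R) :
  injective p -> plane p D -> p w = (1, 0) -> p u = (0, 1) ->
  (forall x, 0 < (p x).1 -> 0 < (p x).2 -> (p x).1 + (p x).2 <= 1 -> False) ->
  (u, c) \in D -> 0 < t < 1 -> on_segment (p u) (p c) (1 - t, t) -> c = w.
Proof.
move=> pinj pl pw pu emp ucD /andP[t0 t1] [s [/andP[s0 s1] [e1 e2]]].
rewrite pu /= mulr0 add0r mulr1 in e1 e2.
have sp : 0 < s.
  by rewrite lt_neqAle s0 andbT; apply: contraTneq t1 => s00; rewrite -s00 in e2; lra.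
have c1 : 0 < (p c).1 by rewrite -(pmulr_rgt0 _ sp) -e1; lra.
have cs : (p c).1 + (p c).2 = 1.
  apply: (mulfI (lt0r_neq0 sp)); lra.
have c2 : (p c).2 <= 0.
  by rewrite leNgt; apply/negP => c2; apply: (emp c) => //; rewrite cs.
have c1n : (p c).1 != 0 by rewrite lt0r_neq0.
have : w \in [set u; c].
  apply: (plane_vertex pinj pl ucD); exists (1 / (p c).1); rewrite pw pu /=; split.
    apply/andP; split; first by apply: divr_ge0 => //; exact: ltW.
    by rewrite ler_pdivrMr //; lra.
  have -> : (p c).2 = 1 - (p c).1 by lra.
  by congr (_, _); field.
rewrite !inE => /orP[] /eqP wE //.
by move: (oner_neq0 R); rewrite -[1]/((1 : R, 0 : R).1) -pw wE pu eqxx.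
Qed.

(** By saturation it is enough that nothing crosses the third side. An edge through an inner point
    of that side has, by [pierce], an end in the empty triangle or starts at [u] or [w]; in the
    latter case it is the side itself. *)
Lemma std_triangle_edge (R : realType) (T : finType) (p : T -> R * R)
    (D : {set T * T}) (v w u : T) :
  injective p -> plane p D -> saturated p D ->
  p v = (0, 0) -> p w = (1, 0) -> p u = (0, 1) ->
  (v, w) \in D -> (v, u) \in D ->
  (forall x, (v, x) \in D -> 0 < (p x).1 -> 0 < (p x).2 -> False) ->
  (w, u) \in D.
Proof.
move=> pinj pl sat pv pw pu vwD vuD emp.
have tri x := @std_triangle_empty R T p D v w u x pinj pl sat pv pw pu vwD vuD emp.
apply: sat => [|a b z abD ne abz [t [/andP[t0 t1] zE]]].
  by apply/eqP => e; move: (oner_neq0 R); rewrite -[1]/((1 : R, 0 : R).1) -pw e pu eqxx.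
have {}zE : z = (1 - t, t) by rewrite zE pw pu /=; congr (_, _); ring.
have [t00|tn0] := eqVneq t 0.
  have zv : z = p w by rewrite zE pw t00 subr0.
  exists w; rewrite !inE eqxx zv; split => //.
  by rewrite -in_set2; apply: (plane_vertex pinj pl abD); rewrite -zv.
have [t11|tn1] := eqVneq t 1.
  have zm : z = p u by rewrite zE pu t11 subrr.
  exists u; rewrite !inE eqxx orbT zm; split => //.
  by rewrite -in_set2; apply: (plane_vertex pinj pl abD); rewrite -zm.
have tp : 0 < t by rewrite lt_neqAle eq_sym tn0.
have tl1 : t < 1 by rewrite lt_neqAle tn1.
have [|||c cab [[c1 c2 cs]|[cE _]]] := pierce pinj pl pv pw pu vwD vuD emp abD abz.
- by rewrite zE /= subr_gt0.
- by rewrite zE.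
- by rewrite zE /= subrK.
- by case: (tri c) => //; rewrite (le_trans cs) // zE /= subrK.
have [c' [ccD abE ccz]] : exists c', [/\ (c, c') \in D, [set a; b] = [set c; c']
    & on_segment (p c) (p c') z].
  move: cab; rewrite !inE => /orP[] /eqP ->; [exists b|exists a]; split => //.
  - exact: plane_sym pl _ _ abD.
  - by rewrite setUC.
  - have [s [s01 ->]] := abz; exists (1 - s); split; first by lra.
    by congr (_, _); ring.
exfalso; move/eqP: ne; apply; rewrite abE.
case/orP: cE => /eqP cE; rewrite cE in ccD ccz *.
- by rewrite (std_no_tail pinj pl pw pu _ ccD _ (t := t)) ?tp ?tl1 -?zE // setUC.
- have spinj : injective (fun x => swap (p x)) by move=> x y /swap_inj /pinj.
  have spl := plane_affine (@swap_inj R) (@swap_comb R) pl.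
  rewrite (@std_no_tail _ _ (fun x => swap (p x)) D w u c' (1 - t)) //.
  + by rewrite pu.
  + by rewrite pw.
  + by move=> x /= x1 x2 xs; apply: (tri x) => //; rewrite addrC.
  + by lra.
  + move: ccz => [s [s01 e]]; exists s; split => //; move: e.
    by rewrite zE /= => -[<- <-]; congr (_, _); ring.
Qed.

(** An edge from [w] into the triangle ends inside, or it crosses the side from [v] to [u] at a
    height [y] strictly between 0 and 1, where no common end can be. *)
Lemma std_sector_empty (R : realType) (T : finType) (p : T -> R * R)
    (D : {set T * T}) (v w u x : T) :
  injective p -> plane p D -> p v = (0, 0) -> p w = (1, 0) -> p u = (0, 1) ->
  (v, u) \in D ->
  (forall x, 0 < (p x).1 -> 0 < (p x).2 -> (p x).1 + (p x).2 <= 1 -> False) ->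
  (w, x) \in D -> 0 < (p x).2 -> (p x).1 + (p x).2 < 1 -> False.
Proof.
move=> pinj pl pv pw pu vuD emp wxD x2 xs.
have [x1|x1] := ltP 0 (p x).1; first by apply: (emp x) => //; exact: ltW.
have d0 : 0 < 1 - (p x).1 by lra.
have dn : 1 - (p x).1 != 0 by rewrite lt0r_neq0.
pose y := (p x).2 / (1 - (p x).1).
have y0 : 0 < y by rewrite divr_gt0.
have y1 : y < 1 by rewrite ltr_pdivrMr //; lra.
have ne : [set v; u] != [set w; x].
  apply/eqP => e; have : w \in [set v; u] by rewrite e !inE eqxx.
  rewrite !inE => /orP[] /eqP e'; move: (oner_neq0 R);
  by rewrite -[1]/((1 : R, 0 : R).1) -pw e' ?pv ?pu eqxx.
have [||q [qvu _ qE]] := plane_compatible pl wxD vuD ne (z := (0, y)).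
- exists y; rewrite pv pu /=; split; first by lra.
  by congr (_, _); ring.
- exists (1 / (1 - (p x).1)); rewrite pw /=; split.
    apply/andP; split; first by apply: divr_ge0 => //; exact: ltW.
    by rewrite ler_pdivrMr //; lra.
  by congr (_, _); rewrite /y; field.
move: qvu y0 y1; rewrite !inE => /orP[] /eqP qE'; move: qE; rewrite qE' ?pv ?pu => -[->];
  by rewrite ltxx.
Qed.

(* In the affine frame with origin [p v] and unit vectors towards [p w] and
   [p u] the triangle is the standard one. *)
Lemma empty_sector_triangle (R : realType) (T : finType) (p : T -> R * R)
    (D : {set T * T}) (v w u : T) :
  injective p -> plane p D -> saturated p D -> (v, w) \in D -> (v, u) \in D ->
  0 < crs (vec (p v) (p w)) (vec (p v) (p u)) ->
  (forall x, (v, x) \in D -> 0 < crs (vec (p v) (p w)) (vec (p v) (p x)) ->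
     0 < crs (vec (p v) (p x)) (vec (p v) (p u)) -> False) ->
  [/\ (w, u) \in D,
      forall x, (w, x) \in D -> 0 < crs (vec (p w) (p u)) (vec (p w) (p x)) ->
        0 < crs (vec (p w) (p x)) (vec (p w) (p v)) -> False
    & forall x, (u, x) \in D -> 0 < crs (vec (p u) (p v)) (vec (p u) (p x)) ->
        0 < crs (vec (p u) (p x)) (vec (p u) (p w)) -> False].
Proof.
move=> pinj pl sat vwD vuD d0 emp.
set a := vec (p v) (p w) in d0 emp *; set b := vec (p v) (p u) in d0 emp *.
have dn := lt0r_neq0 d0.
pose f z := (crs (vec (p v) z) b / crs a b, crs a (vec (p v) z) / crs a b).
pose g y := ((p v).1 + y.1 * a.1 + y.2 * b.1, (p v).2 + y.1 * a.2 + y.2 * b.2).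
have fK : cancel f g.
  move=> [x y]; rewrite /f /g /crs /=; congr (_, _); field; exact: dn.
have fi := can_inj fK.
have fc t x y : f (comb t x y) = comb t (f x) (f y).
  by rewrite /f /comb /crs /=; congr (_, _); field; exact: dn.
have pfi : injective (fun v => f (p v)) by move=> x y /fi /pinj.
have fpl := plane_affine fi fc pl.
have fsat := saturated_affine fi fc sat.
have fv : f (p v) = (0, 0) by rewrite /f /crs /=; congr (_, _); field; exact: dn.
have fw : f (p w) = (1, 0) by rewrite /f /crs /=; congr (_, _); field; exact: dn.
have fu : f (p u) = (0, 1) by rewrite /f /crs /=; congr (_, _); field; exact: dn.
have femp x : (v, x) \in D -> 0 < (f (p x)).1 -> 0 < (f (p x)).2 -> False.
  by move=> vx /=; rewrite !pmulr_lgt0 ?invr_gt0 // => x1 x2; exact: (emp x).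
have ftri x := @std_triangle_empty R T _ D v w u x pfi fpl fsat fv fw fu vwD vuD femp.
have f1 x : crs a b * (f (p x)).1 = crs (vec (p v) (p x)) b.
  by rewrite /f /= mulrC mulfVK.
have f2 x : crs a b * (f (p x)).2 = crs a (vec (p v) (p x)).
  by rewrite /f /= mulrC mulfVK.
split.
- exact: (std_triangle_edge pfi fpl fsat fv fw fu).
- move=> x wxD h1 h2; apply: (std_sector_empty pfi fpl fv fw fu vuD ftri wxD).
    rewrite -(pmulr_rgt0 _ d0) f2; move: h2; rewrite /crs /a /vec /=; lra.
  rewrite -subr_gt0 -(pmulr_rgt0 _ d0) mulrBr mulrDr f1 f2 mulr1.
  by move: h1; rewrite /crs /a /b /vec /=; lra.
- move=> x uxD h1 h2.
  have spinj : injective (fun x => swap (f (p x))) by move=> ? ? /swap_inj /pfi.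
  have spl := plane_affine (@swap_inj R) (@swap_comb R) fpl.
  apply: (@std_sector_empty _ _ (fun x => swap (f (p x))) D v u w x spinj spl) => //.
  + by rewrite fv.
  + by rewrite fu.
  + by rewrite fw.
  + by move=> y /= y1 y2 ys; apply: (ftri y) => //; rewrite addrC.
  + rewrite -(pmulr_rgt0 _ d0) -[(swap _).2]/((f (p x)).1) f1.
    by move: h1; rewrite /crs /b /vec /=; lra.
  + rewrite -subr_gt0 -(pmulr_rgt0 _ d0) mulrBr mulrDr.
    rewrite -[(swap _).1]/((f (p x)).2) -[(swap _).2]/((f (p x)).1) f1 f2 mulr1.
    by move: h2; rewrite /crs /a /b /vec /=; lra.
Qed.

Lemma saturated_extension (R : realType) (T : finType) (p : T -> R * R)
    (D : {set T * T}) :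
  plane p D -> exists D' : {set T * T}, [/\ D \subset D', plane p D' & saturated p D'].
Proof.
have [n] := ubnP (#|[set: T * T]| - #|D|); elim: n D => // n IH D nE pl.
have [sat|/existsNP[x /existsNP[y]]] := pselect (saturated p D); first by exists D.
move=> /not_implyP[xy /not_implyP[cxy /negP xyD]].
pose D' := (x, y) |: ((y, x) |: D).
have DD' : D \subset D' by rewrite /D' setUA subsetUr.
have card' : (#|D| < #|D'|)%N.
  by apply: proper_card; apply/properP; split=> //; exists (x, y) => //; rewrite !inE eqxx.
have inD' a b : (a, b) \in D' -> [set a; b] = [set x; y] \/ (a, b) \in D.
  rewrite !inE => /or3P[/eqP[-> ->]|/eqP[-> ->]|]; [by left| |by right].
  by left; rewrite setUC.
have seg_sym a b z : on_segment (p a) (p b) z -> on_segment (p b) (p a) z.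
  move=> [t [t01 ->]]; exists (1 - t); split; first by lra.
  by congr (_, _); ring.
have segE a b z : [set a; b] = [set x; y] -> on_segment (p a) (p b) z ->
    on_segment (p x) (p y) z.
  move=> e; have : a \in [set x; y] by rewrite -e !inE eqxx.
  have : b \in [set x; y] by rewrite -e !inE eqxx orbT.
  rewrite !inE => /orP[] /eqP be /orP[] /eqP ae; rewrite be ae // in e *; last 2 first.
  - exact: seg_sym.
  - have : x \in [set y; y] by rewrite e !inE eqxx.
    by rewrite !inE orbb (negbTE xy).
  - have : y \in [set x; x] by rewrite e !inE eqxx orbT.
    by rewrite !inE orbb eq_sym (negbTE xy).
have pl' : plane p D'.
  split.
  - move=> a b; rewrite !inE => /or3P[/eqP[-> ->]|/eqP[-> ->]|/(plane_sym pl) ->];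
      by rewrite ?eqxx ?orbT.
  - move=> a; rewrite !inE (negbTE (plane_irr pl a)) orbF.
    by apply/norP; split; apply: contra xy => /eqP[-> ->].
  - by move=> a; have [b abD] := plane_cover pl a; exists b; exact: (subsetP DD').
  - move=> a b /inD' ab c d z /inD' cd ne scd sab.
    case: ab => [abE|abD]; case: cd => [cdE|cdD].
    + by rewrite cdE abE eqxx in ne.
    + by rewrite abE in ne *; apply: cxy ne scd _ => //; exact: segE sab.
    + rewrite cdE in ne *; rewrite eq_sym in ne.
      have [q [q1 q2 q3]] := cxy _ _ _ abD ne sab (segE _ _ _ cdE scd).
      by exists q.
    + exact: (plane_compatible pl abD cdD ne scd sab).
have [|D2 [D'D2 pl2 sat2]] := IH D' _ pl'.
  have := subset_leq_card (subsetT D'); move: nE card'; move: #|[set: T * T]| #|D| #|D'|; lia.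
by exists D2; split => //; exact: subset_trans D'D2.
Qed.

(** * Faces *)

Definition nbh (T : finType) (D : {set T * T}) (v : T) : {set T} :=
  [set u | (v, u) \in D].

Definition dirn (R : realType) (T : finType) (p : T -> R * R) (v u : T) : R :=
  arg (vec (p v) (p u)).

Definition succ (R : realType) (T : finType) (p : T -> R * R) (D : {set T * T})
    (v w : T) : T := nxt (dirn p v) (nbh D v) w.

Definition sector (R : realType) (T : finType) (p : T -> R * R) (D : {set T * T})
    (d : T * T) : R := gap (dirn p d.1) (nbh D d.1) d.2.

(* The inverse of the face permutation: the face on the left of [d] is
   traversed backwards. *)
Definition fprev (R : realType) (T : finType) (p : T -> R * R) (D : {set T * T})
    (d : T * T) : T * T := (succ p D d.1 d.2, d.1).

Lemma vec_neq0 (R : realType) (T : finType) (p : T -> R * R) (u v : T) :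
  injective p -> u != v -> vec (p u) (p v) != (0, 0).
Proof.
move=> pinj; apply: contra => /eqP [/eqP e1 /eqP e2]; apply/eqP/pinj.
move: e1 e2; rewrite !subr_eq0; case: (p u) (p v) => [a b] [c d] /=.
by move=> /eqP -> /eqP ->.
Qed.

Lemma plane_neq (R : realType) (T : finType) (p : T -> R * R) (D : {set T * T})
    (u v : T) : plane p D -> (u, v) \in D -> u != v.
Proof. by move=> pl uvD; apply: contraTneq uvD => ->; exact: (plane_irr pl). Qed.

(** If two edges at [v] had the same direction, the nearer of their other ends would lie on the
    longer edge. *)
Lemma plane_directions (R : realType) (T : finType) (p : T -> R * R)
    (D : {set T * T}) (v : T) :
  injective p -> plane p D -> directions (dirn p v) (nbh D v).
Proof.
move=> pinj pl; split => [u|u w]; rewrite !inE => vuD.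
  by have [] := argP (vec_neq0 pinj (plane_neq pl vuD)).
move=> vwD e; apply/eqP; apply: contraT => uw.
have u0 := vec_neq0 pinj (plane_neq pl vuD).
have w0 := vec_neq0 pinj (plane_neq pl vwD).
have [_ u1 u2] := argP u0; have [_ w1 w2] := argP w0.
rewrite -norm2_gt0 in u0; rewrite -norm2_gt0 in w0.
rewrite /dirn in e; rewrite {}e in u1 u2.
have key x y (k : R) : (v, x) \in D -> (v, y) \in D -> x != y -> 0 <= k <= 1 ->
    (vec (p v) (p y)).1 = k * (vec (p v) (p x)).1 ->
    (vec (p v) (p y)).2 = k * (vec (p v) (p x)).2 -> False.
  move=> vx vy xy k01 /= k1 k2; have : y \in [set v; x].
    apply: (plane_vertex pinj pl vx); exists k; split => //.
    by rewrite [p y]surjective_pairing; congr (_, _); lra.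
  by rewrite !inE ![y == _]eq_sym (negbTE (plane_neq pl vy)) (negbTE xy).
exfalso.
have [nn|nn] := leP (norm2 (vec (p v) (p u))) (norm2 (vec (p v) (p w))).
  apply: (key w u (norm2 (vec (p v) (p u)) / norm2 (vec (p v) (p w)))) => //.
  - by rewrite eq_sym.
  - by rewrite ler_pdivrMr // mul1r nn andbT divr_ge0 // ltW.
  - by rewrite u1 w1 mulrA mulfVK // lt0r_neq0.
  - by rewrite u2 w2 mulrA mulfVK // lt0r_neq0.
apply: (key u w (norm2 (vec (p v) (p w)) / norm2 (vec (p v) (p u)))) => //.
- by rewrite ler_pdivrMr // mul1r (ltW nn) andbT divr_ge0 // ltW.
- by rewrite u1 w1 mulrA mulfVK // lt0r_neq0.
- by rewrite u2 w2 mulrA mulfVK // lt0r_neq0.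
Qed.

Lemma fprev_in (R : realType) (T : finType) (p : T -> R * R) (D : {set T * T})
    (d : T * T) :
  (forall x y, (x, y) \in D -> (y, x) \in D) -> d \in D -> fprev p D d \in D.
Proof.
case: d => v w sym vwD; apply: sym.
by have [] := @nxtP _ _ (dirn p v) (nbh D v) w; rewrite inE.
Qed.

Lemma fprev_inj (R : realType) (T : finType) (p : T -> R * R) (D : {set T * T}) :
  (forall v, directions (dirn p v) (nbh D v)) -> {in D &, injective (fprev p D)}.
Proof.
move=> dir [v w] [v' w'] vwD vwD' [] /= + e; rewrite -{v'}e in vwD' * => e.
by congr (_, _); apply: (nxt_inj (dir v)) e; rewrite inE.
Qed.

Lemma sector_bnd (R : realType) (T : finType) (p : T -> R * R) (D : {set T * T})
    (d : T * T) :
  (forall v, directions (dirn p v) (nbh D v)) -> d \in D ->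
  0 < sector p D d <= 2 * pi.
Proof. by case: d => v w dir vwD; apply: gap_bnd => //; rewrite inE. Qed.

(** The two last conclusions close the orbit [(v, w)], [(u, v)], [(w, u)] of [fprev], so the
    triangle is a face. *)
Lemma convex_sector_triangle (R : realType) (T : finType) (p : T -> R * R)
    (D : {set T * T}) (v w : T) (u := succ p D v w) :
  injective p -> plane p D -> saturated p D -> (v, w) \in D ->
  sector p D (v, w) < pi ->
  [/\ (v, u) \in D, 0 < crs (vec (p v) (p w)) (vec (p v) (p u)),
      (w, u) \in D, succ p D w u = v & succ p D u v = w].
Proof.
move=> pinj pl sat vwD sec.
have dir x := @plane_directions R T p D x pinj pl.
have wN : w \in nbh D v by rewrite inE.
have [uN umin] := nxtP (dirn p v) wN; rewrite -/u in uN umin.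
have vuD : (v, u) \in D by rewrite inE in uN.
have nz x y (xyD : (x, y) \in D) := vec_neq0 pinj (plane_neq pl xyD).
have d0 : 0 < crs (vec (p v) (p w)) (vec (p v) (p u)) by rewrite -ang_lt_pi ?nz.
have emp x : (v, x) \in D -> 0 < crs (vec (p v) (p w)) (vec (p v) (p x)) ->
     0 < crs (vec (p v) (p x)) (vec (p v) (p u)) -> False.
  move=> vx c1 c2; have := umin x; rewrite inE => /(_ vx); rewrite leNgt => /negP; apply.
  by rewrite -[X in X < _]/(ang _ _) -[X in _ < X]/(ang _ _) ang_lt ?nz // c1.
have [wuD e1 e2] := empty_sector_triangle pinj pl sat vwD vuD d0 emp.
have wvD := plane_sym pl vwD; have uvD := plane_sym pl vuD; have uwD := plane_sym pl wuD.
have uniq a b c : (a, b) \in D -> (a, c) \in D ->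
    0 < crs (vec (p a) (p b)) (vec (p a) (p c)) ->
    (forall x, (a, x) \in D -> 0 < crs (vec (p a) (p b)) (vec (p a) (p x)) ->
     0 < crs (vec (p a) (p x)) (vec (p a) (p c)) -> False) -> succ p D a b = c.
  move=> ab ac c0 em; apply: nxt_uniq; rewrite ?inE // => x; rewrite inE => ax.
  rewrite leNgt; apply/negP; rewrite -[X in X < _]/(ang _ _) -[X in _ < X]/(ang _ _).
  by rewrite ang_lt ?nz // => /andP[]; exact: em.
split => //; apply: uniq => //; move: d0; rewrite /crs /vec /=; lra.
Qed.

Definition region (T : finType) (L : eqType) (D : {set T * T})
    (l : T * T -> option L) (c : option L) : {set T * T} := [set d in D | l d == c].

(* [None] labels everything outside the bounded regions.  A label may stand
   for a union of faces. *)
Record faces (R : realType) (T : finType) (L : eqType) (p : T -> R * R)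
    (D : {set T * T}) (l : T * T -> option L) : Prop := Faces {
  faces_fprev : forall d, d \in D -> l (fprev p D d) = l d;
  faces_angle : forall X, region D l (Some X) != finset.set0 ->
    exists j : nat, \sum_(d in region D l (Some X)) sector p D d + 2 * pi
      = pi * (#|region D l (Some X)| + 2 * j)%:R;
  faces_area : forall X,
    0 <= \sum_(d in region D l (Some X)) crs (p d.1) (p d.2);
  faces_outer : pi * #|region D l None|%:R
    < \sum_(d in region D l None) sector p D d
}.

Lemma arg_lt_pi (R : realType) (a : R * R) :
  0 <= a.2 -> (0 < a.1) || (0 < a.2) -> arg a < pi.
Proof.
move=> a2 a12; rewrite /arg a2.
have n0 : 0 < norm2 a.
  rewrite norm2_gt0; apply: contraL a12 => /eqP ->; by rewrite /= ltxx.
have nE := norm2_sqr a; rewrite /dot in nE.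
apply: acos_ltpi; rewrite ltr_pdivlMr // ler_pdivrMr // mulN1r mul1r.
apply/andP; split; last by nra.
by case/orP: a12 => ?; nra.
Qed.

(** Seen from the lowest vertex, the leftmost one in case of a tie, all directions lie in [[0, pi)],
    so the sector after the largest one exceeds [pi]. This makes [faces_outer] strict. *)
Lemma reflex_sector (R : realType) (T : finType) (p : T -> R * R)
    (D : {set T * T}) (v0 : T) :
  injective p -> plane p D -> exists2 d, d \in D & pi < sector p D d.
Proof.
move=> pinj pl.
pose v1 := [arg min_(v < v0) (p v).2]%O.
have v1m u : (p v1).2 <= (p u).2 by rewrite /v1; case: arg_minP => // i _; exact.
pose v := [arg min_(v < v1 | (p v).2 == (p v1).2) (p v).1]%O.
have [v2 vm] : (p v).2 = (p v1).2 /\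
    (forall u, (p u).2 == (p v1).2 -> (p v).1 <= (p u).1).
  by rewrite /v; case: arg_minP => // i /eqP.
have dir x := @plane_directions R T p D x pinj pl.
have lt u : u \in nbh D v -> dirn p v u < pi.
  rewrite inE => vuD; have := plane_neq pl vuD => vu.
  apply: arg_lt_pi; first by rewrite /= subr_ge0 v2.
  rewrite /= !subr_gt0; have := v1m u; rewrite -v2 le_eqVlt => /predU1P[e|->]; last by rewrite orbT.
  rewrite lt_neqAle (vm u) -?v2 ?e // andbT; apply/orP; left.
  apply: contra vu => /eqP e1; apply/eqP/pinj.
  by rewrite [p v]surjective_pairing [p u]surjective_pairing e e1.
have [w0 vw0] := plane_cover pl v.
have w0N : w0 \in nbh D v by rewrite inE.
pose w := [arg max_(w > w0 in nbh D v) dirn p v w]%O.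
have [wN wm] : w \in nbh D v /\ (forall u, u \in nbh D v -> dirn p v u <= dirn p v w).
  by rewrite /w; case: arg_maxP.
exists (v, w); first by rewrite inE in wN.
have [nN _] := nxtP (dirn p v) wN.
have [b _] := dir v; have := b _ nN; have := lt _ wN; have := wm _ nN.
move=> h1 h2 /andP[h3 h4]; rewrite /sector /gap /cang.
by case: (ltP (dirn p v w)) => h; lra.
Qed.

(** A triangle can be labelled by its set of vertices, because only one of the two orientations of
    three points is positive. All angles of size at least [pi] together form the outer region. *)
Lemma triangle_faces (R : realType) (T : finType) (p : T -> R * R)
    (D : {set T * T}) (v0 : T) :
  injective p -> plane p D -> saturated p D ->
  faces p D (fun d => if sector p D d < pi
                      then Some [set d.1; d.2; succ p D d.1 d.2] else None).
Proof.
move=> pinj pl sat.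
have dir x := @plane_directions R T p D x pinj pl.
have sym := plane_sym pl.
have nz x y (xyD : (x, y) \in D) := vec_neq0 pinj (plane_neq pl xyD).
pose tri v w u := [/\ (v, w) \in D, (v, u) \in D, (w, u) \in D,
  0 < crs (vec (p v) (p w)) (vec (p v) (p u)) & succ p D v w = u].
have secT v w u : tri v w u ->
    sector p D (v, w) = ang (vec (p v) (p w)) (vec (p v) (p u)).
  by move=> [_ _ _ _ e]; rewrite /sector /gap -/(succ p D v w) e.
have secL v w u : tri v w u -> sector p D (v, w) < pi.
  by move=> t; rewrite (secT _ _ _ t); case: t => *; rewrite ang_lt_pi ?nz.
have triP v w : (v, w) \in D -> sector p D (v, w) < pi ->
    exists u, [/\ tri v w u, tri w u v & tri u v w].
  move=> vwD s; have [vuD c wuD e1 e2] := convex_sector_triangle pinj pl sat vwD s.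
  exists (succ p D v w); have [wvD [uvD uwD]] := (sym _ _ vwD, (sym _ _ vuD, sym _ _ wuD)).
  by split; split => //; move: c; rewrite /crs /vec /=; lra.
set l := (fun d => _).
have lE v w u : tri v w u -> l (v, w) = Some [set v; w; u].
  by move=> t; rewrite /l (secL _ _ _ t) /=; case: t => _ _ _ _ ->.
have distinct v w u : tri v w u -> [/\ v != w, v != u & w != u].
  by case=> vw vu wu _ _; rewrite !(plane_neq pl).
have fib v w u : tri v w u -> tri w u v -> tri u v w ->
    region D l (Some [set v; w; u]) = [set (v, w); (u, v); (w, u)].
  move=> t1 t2 t3; apply/setP => -[a b]; rewrite !inE; apply/andP/idP; last first.
    move=> /orP[/orP[]|] /eqP[-> ->].
    - by rewrite (lE _ _ _ t1); case: t1.
    - rewrite (lE _ _ _ t3); case: t3 => ? _ _ _ _; split => //.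
      by apply/eqP; congr Some; apply/setP => x; rewrite !inE; do 3 case: (x == _).
    - rewrite (lE _ _ _ t2); case: t2 => ? _ _ _ _; split => //.
      by apply/eqP; congr Some; apply/setP => x; rewrite !inE; do 3 case: (x == _).
  move=> [abD]; rewrite {1}/l; case: ifPn => // s /eqP[e].
  have [c [tab _ _]] := triP _ _ abD s.
  have ce : succ p D a b = c by case: tab.
  rewrite /= ce in e.
  have [ab ac bc] := distinct _ _ _ tab.
  have : a \in [set v; w; u] by rewrite -e !inE eqxx.
  have : b \in [set v; w; u] by rewrite -e !inE eqxx orbT.
  have : c \in [set v; w; u] by rewrite -e !inE eqxx !orbT.
  have d1 : 0 < crs (vec (p v) (p w)) (vec (p v) (p u)) by case: t1.
  have d2 : 0 < crs (vec (p a) (p b)) (vec (p a) (p c)) by case: tab.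
  (* Repeated vertices are excluded, the cyclic arrangements are the claim, and the three odd
     permutations have the wrong orientation. *)
  rewrite !inE -!orbA => /or3P[] /eqP c1 /or3P[] /eqP b1 /or3P[] /eqP a1;
    move: ab ac bc d2; rewrite ?a1 ?b1 ?c1 ?eqxx ?orbT // => _ _ _ d2;
    exfalso; move: d1 d2; rewrite /crs /vec /=; lra.
have sum3 (F : T * T -> R) v w u : tri v w u -> tri w u v -> tri u v w ->
    \sum_(d in region D l (Some [set v; w; u])) F d = F (v, w) + F (u, v) + F (w, u).
  move=> t1 t2 t3; rewrite (fib _ _ _ t1 t2 t3).
  have [vw vu wu] := distinct _ _ _ t1.
  rewrite eq_sym in wu; rewrite -setUA big_setU1 /=; last first.
    by rewrite !inE !xpair_eqE (negbTE vu) (negbTE vw).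
  rewrite big_setU1 /=; last by rewrite !inE !xpair_eqE (negbTE wu).
  by rewrite big_set1 addrA.
have fibP X : region D l (Some X) != finset.set0 ->
    exists v w u, [/\ tri v w u, tri w u v, tri u v w & X = [set v; w; u]].
  move=> /set0Pn[[v w]]; rewrite inE {1}/l => /andP[vwD].
  case: ifPn => // s /eqP[XE]; have [u [t1 t2 t3]] := triP _ _ vwD s.
  exists v, w, u; split => //; rewrite -XE /=; by case: t1 => _ _ _ _ ->.
have lt_fprev d : d \in D -> sector p D d < pi -> sector p D (fprev p D d) < pi.
  case: d => v w vwD s; have [u [t1 t2 t3]] := triP _ _ vwD s.
  by rewrite /fprev /=; case: (t1) => _ _ _ _ ->; exact: secL t3.
have fin d : d \in D -> fprev p D d \in D by exact: fprev_in.
split.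
- move=> [v w] vwD; case: (ltP (sector p D (v, w)) pi) => [s|s].
    have [u [t1 t2 t3]] := triP _ _ vwD s.
    rewrite (lE _ _ _ t1) /fprev /=; case: (t1) => _ _ _ _ ->; rewrite (lE _ _ _ t3).
    by congr Some; apply/setP => x; rewrite !inE; do 3 case: (x == _).
  (* If [fprev] led into a triangle, the corner of this triangle at [v] would have the same
     successor as [w], hence be the sector at hand. *)
  rewrite {2}/l ltNge s /= /l; case: ifPn => // s'; exfalso; move: s; apply/negP.
  rewrite -ltNge; have vw'D := fin _ vwD.
  have [x [t1 t2 t3]] := triP _ _ vw'D s'.
  have [vxD _ _ _ e] := t2.
  suff -> : w = x by exact: secL t2.
  by apply: (nxt_inj (dir v)); rewrite ?inE // -!/(succ p D v _) e.
- move=> X /fibP[v [w [u [t1 t2 t3 ->]]]]; exists 0%N.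
  rewrite sum3 // (fib _ _ _ t1 t2 t3) muln0 addn0 -setUA cardsU1 cards2 !inE !xpair_eqE.
  have [vw vu wu] := distinct _ _ _ t1; rewrite eq_sym in wu.
  rewrite (negbTE vu) (negbTE vw) (negbTE wu) /=.
  rewrite (secT _ _ _ t1) (secT _ _ _ t2) (secT _ _ _ t3).
  have d : 0 < crs (vec (p v) (p w)) (vec (p v) (p u)) by case: t1.
  by have := triangle_ang d; lra.
- move=> X; have [->|/fibP[v [w [u [t1 t2 t3 ->]]]]] := eqVneq (region D l (Some X)) finset.set0.
    by rewrite big_set0.
  rewrite (sum3 (fun d => crs (p d.1) (p d.2))) //=.
  by case: t1 => _ _ _ + _; rewrite /crs /vec /=; lra.
- have ge d : d \in region D l None -> d \in D /\ pi <= sector p D d.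
    by rewrite inE /l => /andP[dD]; case: ltP.
  have [d dD ds] := reflex_sector v0 pinj pl.
  have dN : d \in region D l None by rewrite inE dD /l ltNge ltW.
  rewrite -subr_gt0 mulr_natr.
  rewrite -sumr_const -sumrB (bigD1 d) //= ltr_pwDl ?subr_gt0 //.
  by apply: sumr_ge0 => d' /andP[/ge[_ h] _]; rewrite subr_ge0.
Qed.

Lemma sum_region (R : nmodType) (T : finType) (L : eqType) (D : {set T * T})
    (l : T * T -> option L) (c : option L) (F : T * T -> R) :
  \sum_(d in region D l c) F d = \sum_(d in D) if l d == c then F d else 0.
Proof. by rewrite -big_mkcondr; apply: eq_bigl => d; rewrite inE. Qed.

(** * Deleting an edge *)

Definition del_edge (T : finType) (D : {set T * T}) (a b : T) : {set T * T} :=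
  D :\ (a, b) :\ (b, a).

Lemma nbh_del (T : finType) (D : {set T * T}) (a b x : T) :
  nbh (del_edge D a b) x =
  if x == a then nbh D x :\ b else if x == b then nbh D x :\ a else nbh D x.
Proof.
apply/setP => y; rewrite !inE !xpair_eqE; case: (eqVneq x a) => [->|xa] /=.
  by rewrite !inE; case: (eqVneq a b) => [->|_] /=; case: (y == b).
by case: (eqVneq x b) => [->|xb]; rewrite !inE ?andbT.
Qed.

Lemma succ_del (R : realType) (T : finType) (p : T -> R * R) (D : {set T * T})
    (a b a' x w : T) (D' := del_edge D a b) :
  (forall v, directions (dirn p v) (nbh D v)) ->
  a != b -> (a, a') \in D -> succ p D a a' = b -> a' != b -> x != b ->
  (x, w) \in D' ->
  if (x == a) && (w == a')
  then succ p D' x w = succ p D a b /\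
       sector p D' (x, w) = sector p D (a, a') + sector p D (a, b)
  else succ p D' x w = succ p D x w /\ sector p D' (x, w) = sector p D (x, w).
Proof.
move=> dir ab aa'D e a'b xb xwD'.
have a'N : a' \in nbh D a by rewrite inE.
rewrite /sector /succ /= nbh_del (negbTE xb).
have [xa|xa] := eqVneq x a => //=; rewrite xa.
have [wa|wa] := eqVneq w a'.
  by rewrite wa; exact: (nxtD1 (dir a) a'N e).
have wN : w \in nbh D a by move: xwD'; rewrite xa !inE => /and3P[].
have wb : w != b.
  by move: xwD'; rewrite xa !inE !xpair_eqE eqxx /= => /and3P[].
have -> := nxtD1_neq (dir a) a'N e wN wb wa; split => //.
by rewrite /gap (nxtD1_neq (dir a) a'N e wN wb wa).
Qed.

Lemma del_edgeC (T : finType) (D : {set T * T}) (a b : T) :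
  del_edge D a b = del_edge D b a.
Proof. by apply/setP => d; rewrite !inE andbCA. Qed.

(** Deletion adds the sectors of [(a, b)] and [(b, a)] to those of their predecessors [(a, a')] and
    [(b, b')]. Once both sides of the edge have the same label, all four darts carry it, so the
    angle sum of every label is preserved. *)
Lemma label_del (R : realType) (T : finType) (p : T -> R * R) (L : eqType)
    (D : {set T * T}) (l : T * T -> option L) (a b : T) (D' := del_edge D a b) :
  (forall x y, (x, y) \in D -> (y, x) \in D) ->
  (forall v, directions (dirn p v) (nbh D v)) ->
  a != b -> (a, b) \in D ->
  (exists2 x, (a, x) \in D & x != b) -> (exists2 x, (b, x) \in D & x != a) ->
  (forall d, d \in D -> l (fprev p D d) = l d) -> l (a, b) = l (b, a) ->
  (forall d, d \in D' -> l (fprev p D' d) = l d) /\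
  (forall c, \sum_(d in region D' l c) sector p D' d
             = \sum_(d in region D l c) sector p D d).
Proof.
move=> sym dir ab abD [x axD xb] [y byD ya] lf lab.
have baD := sym _ _ abD.
have inN u v : (u, v) \in D -> v \in nbh D u by rewrite inE.
have [a' a'N ea] := nxt_surj (dir a) (inN _ _ abD).
have [b' b'N eb] := nxt_surj (dir b) (inN _ _ baD).
have aa'D : (a, a') \in D by rewrite inE in a'N.
have bb'D : (b, b') \in D by rewrite inE in b'N.
have a'b : a' != b.
  apply/eqP => e; have := nxt_neq (dir a) (inN _ _ abD) (inN _ _ axD) xb.
  by rewrite -{1}e ea eqxx.
have b'a : b' != a.
  apply/eqP => e; have := nxt_neq (dir b) (inN _ _ baD) (inN _ _ byD) ya.
  by rewrite -{1}e eb eqxx.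
have sa u w := @succ_del R T p D a b a' u w dir ab aa'D ea a'b.
have ba : b != a by rewrite eq_sym.
have sb u w := @succ_del R T p D b a b' u w dir ba bb'D eb b'a.
rewrite -[del_edge D b a]del_edgeC -/D' in sa sb.
have laa' : l (a, a') = l (b, a) by rewrite -lf // /fprev /= /succ ea.
have lbb' : l (b, b') = l (a, b) by rewrite -lf // /fprev /= /succ eb.
have D'D d : d \in D' -> d \in D by rewrite !inE => /and3P[].
have chg d : d \in D' -> d != (a, a') -> d != (b, b') ->
    fprev p D' d = fprev p D d /\ sector p D' d = sector p D d.
  case: d => u w uwD'; rewrite !xpair_eqE => na nb.
  have [ub|ub] := eqVneq u b.
    rewrite ub eqxx /= in nb uwD' *; have := sb b w ba uwD'.
    by rewrite (negbTE nb) andbF /fprev /= => -[-> ->].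
  by have := sa u w ub uwD'; rewrite (negbTE na) /fprev /= => -[-> ->].
have aa'D' : (a, a') \in D' by rewrite !inE !xpair_eqE (negbTE ab) (negbTE a'b) aa'D andbF.
have bb'D' : (b, b') \in D' by rewrite !inE !xpair_eqE (negbTE ba) (negbTE b'a) bb'D andbF.
have := sa a a' ab aa'D'; rewrite !eqxx /= => -[na ga].
have := sb b b' ba bb'D'; rewrite !eqxx /= => -[nb gb].
split.
  move=> d dD'; have [->|da] := eqVneq d (a, a').
    by rewrite /fprev /= na laa' -lab -(lf _ abD).
  have [->|db] := eqVneq d (b, b').
    by rewrite /fprev /= nb lbb' lab -(lf _ baD).
  by have [-> _] := chg d dD' da db; exact: lf (D'D _ dD').
move=> c; rewrite !sum_region.
have neq : (a, a') != (b, b') by rewrite xpair_eqE (negbTE ab).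
rewrite (bigD1 (a, a')) //= (bigD1 (b, b')) /=; last by rewrite bb'D' eq_sym.
rewrite [RHS](big_setD1 (a, b)) //= [in RHS](big_setD1 (b, a)) /=; last first.
  by rewrite !inE xpair_eqE (negbTE ba) baD.
rewrite -/D' [in RHS](bigD1 (a, a')) //= [in RHS](bigD1 (b, b')) /=; last by rewrite bb'D' eq_sym.
have -> : \sum_(i | (i \in D') && (i != (a, a')) && (i != (b, b')))
    (if l i == c then sector p D' i else 0) =
  \sum_(i | (i \in D') && (i != (a, a')) && (i != (b, b')))
    (if l i == c then sector p D i else 0).
  by apply: eq_bigr => d /andP[/andP[dD' da] db]; have [_ ->] := chg d dD' da db.
rewrite ga gb laa' lbb' lab; case: (l (b, a) == c); ring.
Qed.

Lemma sum_merge (R : nmodType) (T : finType) (L : eqType) (D : {set T * T})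
    (l : T * T -> option L) (X Y Z c : option L) (F : T * T -> R) :
  (Z == X) || (Z == Y) ->
  \sum_(d in region D (fun d => if (l d == X) || (l d == Y) then Z else l d) c) F d
  = if c == Z
    then if X == Y then \sum_(d in region D l X) F d
         else \sum_(d in region D l X) F d + \sum_(d in region D l Y) F d
    else if (c == X) || (c == Y) then 0 else \sum_(d in region D l c) F d.
Proof.
move=> ZXY; rewrite !sum_region.
have [->|cZ] := eqVneq c Z.
  have cond x : ((if (x == X) || (x == Y) then Z else x) == Z) = (x == X) || (x == Y).
    case: ifPn => [_|]; first by rewrite eqxx.
    by apply: contraNF => /eqP ->.
  have [XY|XY] := eqVneq X Y.
    by apply: eq_bigr => d _; rewrite cond -XY orbb.
  rewrite -big_split; apply: eq_bigr => d _ /=; rewrite cond.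
  have [->|] := eqVneq (l d) X; first by rewrite (negbTE XY) addr0.
  by rewrite add0r.
have [cXY|cXY] := boolP ((c == X) || (c == Y)).
  apply: big1 => d _; case: ifPn => // /eqP e; move: e cXY cZ; case: ifPn => [_ ->|].
    by rewrite eqxx.
  by move=> /negbTE h <-; rewrite h.
apply: eq_bigr => d _; have [h|h] := boolP ((l d == X) || (l d == Y));
  rewrite // [Z == c]eq_sym (negbTE cZ).
by case: eqP => // e; rewrite -e h in cXY.
Qed.

Lemma sum_del (R : nmodType) (T : finType) (L : eqType) (D : {set T * T})
    (l : T * T -> option L) (a b : T) (c : option L) (F : T * T -> R) :
  a != b -> (a, b) \in D -> (b, a) \in D -> l (a, b) = l (b, a) ->
  \sum_(d in region D l c) F d =
  (if c == l (a, b) then F (a, b) + F (b, a) else 0)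
    + \sum_(d in region (del_edge D a b) l c) F d.
Proof.
move=> ab abD baD e; rewrite !sum_region (big_setD1 (a, b)) //= (big_setD1 (b, a)) /=.
  by rewrite -e addrA eq_sym; case: ifP; rewrite ?addr0.
by rewrite !inE xpair_eqE eq_sym (negbTE ab) baD.
Qed.

(** Angle sums add up, and two darts disappear. Two bounded regions give [k1 + k2 - 2] sides and
    [j1 + j2]; a bounded region on both sides of the edge loses two sides and passes from [j] to
    [j + 1]. A bounded region joining the outer one brings an angle sum of at least [pi * (k - 2)],
    so the outer excess remains strict. *)
Lemma faces_del (R : realType) (T : finType) (p : T -> R * R) (L : eqType)
    (D : {set T * T}) (l : T * T -> option L) (a b : T) :
  (forall x y, (x, y) \in D -> (y, x) \in D) ->
  (forall v, directions (dirn p v) (nbh D v)) ->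
  a != b -> (a, b) \in D ->
  (exists2 x, (a, x) \in D & x != b) -> (exists2 x, (b, x) \in D & x != a) ->
  faces p D l -> exists l' : T * T -> option L, faces p (del_edge D a b) l'.
Proof.
move=> sym dir ab abD axD byD [lf la lA lo].
have baD := sym _ _ abD.
set X := l (a, b); set Y := l (b, a).
(* The merged region is the outer one as soon as one of the two is. *)
pose Z := if Y is None then Y else X.
have ZXY : (Z == X) || (Z == Y) by rewrite /Z; case: (Y) => [?|]; rewrite ?eqxx ?orbT.
pose l' d := if (l d == X) || (l d == Y) then Z else l d.
have l'f d : d \in D -> l' (fprev p D d) = l' d by move=> /lf e; rewrite /l' e.
have l'ab : l' (a, b) = Z by rewrite /l' eqxx.
have l'ba : l' (b, a) = Z by rewrite /l' eqxx orbT.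
have e' : l' (a, b) = l' (b, a) by rewrite l'ab l'ba.
have [f' s'] := label_del sym dir ab abD axD byD l'f e'.
have cardR (A : {set T * T}) : #|A|%:R = \sum_(d in A) 1 :> R by rewrite sumr_const.
have XinD : (a, b) \in region D l X by rewrite inE abD eqxx.
have YinD : (b, a) \in region D l Y by rewrite inE baD eqxx.
have Xn0 : region D l X != finset.set0 by apply/set0Pn; exists (a, b).
have Yn0 : region D l Y != finset.set0 by apply/set0Pn; exists (b, a).
have Sang c := etrans (s' c) (sum_merge D l c (sector p D) ZXY).
have Scard c := etrans (esym (@sum_del R _ _ D l' a b c (fun=> 1) ab abD baD e'))
  (sum_merge D l c (fun=> 1) ZXY).
have Sarea c := etrans
  (esym (@sum_del R _ _ D l' a b c (fun d => crs (p d.1) (p d.2)) ab abD baD e'))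
  (sum_merge D l c (fun d => crs (p d.1) (p d.2)) ZXY).
have crs0 : crs (p a) (p b) + crs (p b) (p a) = 0 by rewrite /crs; ring.
have K0 (A : {set T * T}) : (A != finset.set0) = (\sum_(d in A) (1 : R) != 0).
  by rewrite -cardR pnatr_eq0 cards_eq0.
have la' c : region D l (Some c) != finset.set0 -> exists j : nat,
    \sum_(d in region D l (Some c)) sector p D d + 2 * pi =
    pi * (\sum_(d in region D l (Some c)) 1 + 2 * j%:R).
  by move=> /la[j ->]; exists j; rewrite natrD natrM cardR.
exists l'; split => //.
- move=> c; rewrite K0 Sang.
  suff H : \sum_(d in region (del_edge D a b) l' (Some c)) (1 : R) != 0 ->
      exists j : nat, (if Some c == Z
        then if X == Y then \sum_(d in region D l X) sector p D d
          else \sum_(d in region D l X) sector p D d + \sum_(d in region D l Y) sector p D d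
        else if (Some c == X) || (Some c == Y) then 0
          else \sum_(d in region D l (Some c)) sector p D d) + 2 * pi =
      pi * (\sum_(d in region (del_edge D a b) l' (Some c)) 1 + 2 * j%:R).
    by move=> /H[j ->]; exists j; rewrite natrD natrM cardR.
  have := Scard (Some c); rewrite l'ab.
  have [cZ|cZ] := eqVneq (Some c) Z; last first.
    rewrite add0r; case: ifPn => _ ->; first by rewrite eqxx.
    by rewrite -K0; exact: la'.
  have [X0 XE] : exists X0, X = Some X0.
    by move: cZ; rewrite /Z; case: (Y) => // Y0 <-; exists c.
  have [Y0 YE] : exists Y0, Y = Some Y0.
    by move: cZ; rewrite /Z; case: (Y) => // Y0; exists Y0.
  rewrite XE in Xn0 *; rewrite YE in Yn0 *.
  have [j1 e1] := la' _ Xn0; have [j2 e2] := la' _ Yn0.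
  case: eqP => _ h _.
    exists j1.+1; rewrite e1 -h -natr1; ring.
  exists (j1 + j2)%N; rewrite natrD.
  move: e1 e2 h; set k1 := \sum_(d in _) 1; set k2 := \sum_(d in _) 1;
    set k3 := \sum_(d in _) 1 => e1 e2 h.
  have -> : k3 = k1 + k2 - 2 by rewrite -h; ring.
  by move: e1 e2; lra.
- move=> c; have := Sarea (Some c); rewrite /= crs0 if_same add0r => ->.
  case: ifP => [/eqP cZ|_]; last by case: ifP.
  have [X0 XE] : exists X0, X = Some X0.
    by move: cZ; rewrite /Z; case: (Y) => // Y0 <-; exists c.
  have [Y0 YE] : exists Y0, Y = Some Y0.
    by move: cZ; rewrite /Z; case: (Y) => // Y0; exists Y0.
  by rewrite XE YE; case: ifP => // _; exact: addr_ge0.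
- have pos Y0 : region D l (Some Y0) != finset.set0 ->
      pi * (\sum_(d in region D l (Some Y0)) 1 - 2)
      <= \sum_(d in region D l (Some Y0)) sector p D d.
    move=> /la'[j]; have : 0 <= pi * j%:R :> R by rewrite mulr_ge0 ?pi_ge0.
    lra.
  rewrite cardR in lo.
  rewrite cardR Sang; have := Scard None; rewrite l'ab.
  have p0 := @pi_gt0 R.
  have [Zn|Zn] := eqVneq None Z; last first.
    have -> : (None == X) || (None == Y) = false.
      apply/negbTE; apply: contra Zn; rewrite /Z.
      by case: (Y) => [Y0|]; case: (X) => [X0|].
    by rewrite add0r => ->; exact: lo.
  have [XY|XY] := eqVneq X Y.
    have XN : X = None by move: Zn; rewrite /Z -XY; case: (X).
    rewrite XN; set k := \sum_(d in _) 1; set k' := \sum_(d in _) 1 => h.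
    by apply: le_lt_trans lo; rewrite ler_pM2l // -/k' -h; lra.
  have [[XN [Y0 YE]]|[YN [X0 XE]]] : (X = None /\ exists Y0, Y = Some Y0) \/
      (Y = None /\ exists X0, X = Some X0).
    move: Zn XY; rewrite /Z; case: (Y) => [Y0|]; case: (X) => [X0|] //.
      by move=> _ _; left; split => //; exists Y0.
    by move=> _ _; right; split => //; exists X0.
  - rewrite YE in Yn0; have := pos _ Yn0; rewrite XN YE.
    move: lo; set k1 := \sum_(d in _) 1; set k2 := \sum_(d in _) 1.
    set k := \sum_(d in _) 1 => lo h1 h.
    have -> : k = k1 + k2 - 2 by rewrite -h; ring.
    by move: lo h1; lra.
  - rewrite XE in Xn0; have := pos _ Xn0; rewrite XE YN.
    move: lo; set k1 := \sum_(d in _) 1; set k2 := \sum_(d in _) 1.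
    set k := \sum_(d in _) 1 => lo h1 h.
    have -> : k = k1 + k2 - 2 by rewrite -[k1 + k2]addrC -h; ring.
    by move: lo h1; lra.
Qed.

Lemma faces_plane (R : realType) (T : finType) (p : T -> R * R)
    (D : {set T * T}) (v0 : T) :
  injective p -> plane p D -> exists l : T * T -> option {set T}, faces p D l.
Proof.
move=> pinj pl; have [H [DH plH satH]] := saturated_extension pl.
have dirH v := @plane_directions R T p H v pinj plH.
suff main n (E : {set T * T}) (l : T * T -> option {set T}) :
    (#|E| < n)%N -> D \subset E -> E \subset H ->
    (forall x y, (x, y) \in E -> (y, x) \in E) -> faces p E l ->
    exists l' : T * T -> option {set T}, faces p D l'.
  exact: (main _ H _ (ltnSn _) DH (subxx _) (plane_sym plH)
    (triangle_faces v0 pinj plH satH)).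
elim: n E l => // n IH E l En DE EH symE fE.
have [<-|] := eqVneq E D; first by exists l.
rewrite eqEsubset DE andbT => /subsetPn[[a b] abE abD].
have baD : (b, a) \notin D by apply: contra abD; exact: (plane_sym pl).
have ab : a != b by apply: plane_neq plH (subsetP EH _ abE).
have dirE v : directions (dirn p v) (nbh E v).
  by apply: directionsS (dirH v); apply/subsetP => x; rewrite !inE; exact: (subsetP EH).
(* As [D] leaves no vertex isolated, both ends of the deleted edge keep an edge, and no vertex loses
   its last sector. *)
have nbr x y : (x, y) \notin D -> exists2 z, (x, z) \in E & z != y.
  move=> xyD; have [z xzD] := plane_cover pl x; exists z; first exact: (subsetP DE).
  by apply: contraNneq xyD => <-.
have [l' fl'] := faces_del symE dirE ab abE (nbr _ _ abD) (nbr _ _ baD) fE.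
have DE' : D \subset del_edge E a b.
  apply/subsetP => d dD; rewrite !inE (subsetP DE) // andbT; apply/andP; split.
    by apply: contraNneq baD => <-.
  by apply: contraNneq abD => <-.
apply: IH fl' => //.
- have : (#|del_edge E a b| < #|E|)%N.
    apply: proper_card; apply/properP; split.
      by apply/subsetP => d; rewrite !inE => /and3P[].
    by exists (a, b); rewrite // !inE eqxx /= andbF.
  by move=> h; rewrite -ltnS; exact: leq_trans En.
- by apply: subset_trans EH; apply/subsetP => d; rewrite !inE => /and3P[].
- move=> x y; rewrite !inE !xpair_eqE => /and3P[h1 h2 /symE ->].
  rewrite andbT; apply/andP; split; [apply: contra h2|apply: contra h1];
    by move=> /andP[/eqP -> /eqP ->]; rewrite !eqxx.
Qed.

(** * Weights of angles *)

Definition wide (R : realType) (th : R) : nat :=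
  if th <= pi / 3 then 0%N else if th < 2 * pi / 3 then 1%N else 2%N.

Lemma wide_le2 (R : realType) (th : R) : (wide th <= 2)%N.
Proof. by rewrite /wide; case: ifP => // _; case: ifP. Qed.

Lemma wide_linear (R : realType) (th : R) : 0 < th -> pi * (wide th)%:R <= 3 * th.
Proof.
move=> th0; rewrite /wide; have := @pi_gt0 R.
by case: (leP th (pi / 3)) => h1; last case: (ltP th (2 * pi / 3)) => h2; lra.
Qed.

Lemma wide_linear_eq (R : realType) (th : R) :
  0 < th -> pi * (wide th)%:R = 3 * th -> 3 * th = 2 * pi.
Proof.
move=> th0; rewrite /wide; have := @pi_gt0 R.
by case: (leP th (pi / 3)) => h1; last case: (ltP th (2 * pi / 3)) => h2; lra.
Qed.

(** The map [th -> pi - th] exchanges the weights 0 and 2, since both of their ranges include the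
    threshold. *)
Lemma wide_compl (R : realType) (th : R) :
  (wide th + wide (pi - th))%N = 2%N.
Proof.
rewrite /wide; have p0 := @pi_gt0 R.
case: (leP th (pi / 3)) => h1; case: (leP (pi - th) (pi / 3)) => h2;
  case: (ltP th (2 * pi / 3)) => h3; case: (ltP (pi - th) (2 * pi / 3)) => h4 //; exfalso; lra.
Qed.

(** The unit circles about [a] and [b] pass through the origin and meet again in [a + b]. The error
    [c - (a + b)] is orthogonal to [a - b] and to [c], which are nonzero and orthogonal to each
    other, so it vanishes. *)
Lemma rhombus (R : realType) (a b c : R * R) :
  dot a a = 1 -> dot b b = 1 -> c != (0, 0) -> a != b ->
  dot (vec a c) (vec a c) = 1 -> dot (vec b c) (vec b c) = 1 ->
  c = (a.1 + b.1, a.2 + b.2).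
Proof.
move: a b c => [a1 a2] [b1 b2] [c1 c2]; rewrite -dot_eq0 /dot /vec /= => ha hb hc ab hac hbc.
have ab0 : (a1 - b1) ^+ 2 + (a2 - b2) ^+ 2 != 0.
  rewrite paddr_eq0 ?sqr_ge0 // !sqrf_eq0 !subr_eq0; apply: contra ab.
  by move=> /andP[/eqP -> /eqP ->].
pose e1 := c1 - (a1 + b1); pose e2 := c2 - (a2 + b2).
have d1 : e1 * (a1 - b1) + e2 * (a2 - b2) = 0 by rewrite /e1 /e2; lra.
have d2 : e1 * c1 + e2 * c2 = 0 by rewrite /e1 /e2; lra.
have d3 : c1 * (a1 - b1) + c2 * (a2 - b2) = 0 by lra.
pose k := (a1 - b1) * c2 - (a2 - b2) * c1.
have k0 : k != 0.
  rewrite -sqrf_eq0; have -> : k ^+ 2 =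
    ((a1 - b1) ^+ 2 + (a2 - b2) ^+ 2) * (c1 * c1 + c2 * c2)
    - (c1 * (a1 - b1) + c2 * (a2 - b2)) ^+ 2 by rewrite /k; ring.
  by rewrite d3 expr0n /= subr0 mulf_neq0.
have z1 : e1 = 0.
  apply: (mulIf k0); rewrite mul0r.
  transitivity (c2 * (e1 * (a1 - b1) + e2 * (a2 - b2)) - (a2 - b2) * (e1 * c1 + e2 * c2)).
    by rewrite /k; ring.
  by rewrite d1 d2 !mulr0 subrr.
have z2 : e2 = 0.
  apply: (mulIf k0); rewrite mul0r.
  transitivity ((a1 - b1) * (e1 * c1 + e2 * c2) - c1 * (e1 * (a1 - b1) + e2 * (a2 - b2))).
    by rewrite /k; ring.
  by rewrite d1 d2 !mulr0 subrr.
by congr (_, _); apply/eqP; rewrite -subr_eq0 ?[_ - _]z1 ?[_ - _]z2.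
Qed.

(** * Bounded regions with unit edges *)

Lemma orbit_card3 (I : finType) (f : I -> I) (A : {set I}) (x : I) :
  (forall y, y \in A -> f y \in A) -> {in A &, injective f} ->
  (forall y, y \in A -> f y != y) -> (forall y, y \in A -> f (f y) != y) ->
  #|A| = 3%N -> x \in A ->
  A = [set x; f x; f (f x)] /\ f (f (f x)) = x.
Proof.
move=> fA fi f1 f2 cA xA.
have x1 := fA _ xA; have x2 := fA _ x1.
have n01 y : y \in A -> y != f y by rewrite eq_sym; exact: f1.
have n02 y : y \in A -> y != f (f y) by rewrite eq_sym; exact: f2.
have AE : A = [set x; f x; f (f x)].
  apply/esym/eqP; rewrite eqEcard cA !subUset !finset.sub1set xA x1 x2 /=.
  by rewrite -setUA !cardsU1 cards1 !inE negb_or n01 ?n02 ?n01.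
split=> //; have := fA _ x2; rewrite AE !inE -orbA.
case/or3P => /eqP e //.
  by have := f2 _ xA; rewrite (fi _ _ x2 xA e) eqxx.

by have := f1 _ x2; rewrite e eqxx.
Qed.

Lemma orbit_card4 (I : finType) (f : I -> I) (A : {set I}) (x : I) :
  (forall y, y \in A -> f y \in A) -> {in A &, injective f} ->
  (forall y, y \in A -> f y != y) -> (forall y, y \in A -> f (f y) != y) ->
  #|A| = 4%N -> x \in A ->
  [/\ A = x |: (f x |: (f (f x) |: [set f (f (f x))])),
      uniq [:: x; f x; f (f x); f (f (f x))] & f (f (f (f x))) = x].
Proof.
move=> fA fi f1 f2 cA xA.
have n01 y : y \in A -> y != f y by rewrite eq_sym; exact: f1.
have n02 y : y \in A -> y != f (f y) by rewrite eq_sym; exact: f2.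
have x1 := fA _ xA; have x2 := fA _ x1; have x3 := fA _ x2; have x4 := fA _ x3.
(* A 3-cycle would leave a fourth element that can only be mapped to itself. *)
have f3 : f (f (f x)) != x.
  apply/eqP => e3.
  have [y yA] : exists2 y, y \in A & y \notin [set x; f x; f (f x)].
    apply/subsetPn; apply/negP => /subset_leq_card; rewrite cA.
    rewrite -setUA !cardsU1 cards1; do 2 case: (_ \notin _) => //.
  rewrite !inE !negb_or -andbA => /and3P[y0 y1 y2].
  have AE : A = y |: [set x; f x; f (f x)].
    apply/esym/eqP; rewrite eqEcard cA !subUset !finset.sub1set yA xA x1 x2 /=.
    by rewrite -setUA !cardsU1 cards1 !inE !negb_or y0 y1 y2 !n01 ?n02.
  have := fA _ yA; rewrite AE !inE -!orbA.
  case/or4P => /eqP e.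
  - by have := f1 _ yA; rewrite e eqxx.
  - by case/eqP: y2; apply: fi => //; rewrite e e3.
  - by case/eqP: y0; apply: fi.
  - by case/eqP: y1; apply: fi.
have un : uniq [:: x; f x; f (f x); f (f (f x))].
  by rewrite /= !inE !negb_or !n01 ?n02 // eq_sym f3.
have AE : A = x |: (f x |: (f (f x) |: [set f (f (f x))])).
  apply/esym/eqP; rewrite eqEcard cA !subUset !finset.sub1set xA x1 x2 x3 /=.
  move: un; rewrite /= !inE => /and4P[h1 h2 h3 _].
  by rewrite !cardsU1 cards1 !inE h1 h2 h3.
split=> //; have := x4; rewrite AE !inE.
case/or4P => /eqP e //.
- by case/eqP: f3; apply: fi.
- by have := f2 _ x2; rewrite e eqxx.
- by have := f1 _ x3; rewrite e eqxx.
Qed.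

Definition unit_edges (R : realType) (T : finType) (p : T -> R * R)
    (D : {set T * T}) : Prop :=
  forall u v, (u, v) \in D -> dot (vec (p u) (p v)) (vec (p u) (p v)) = 1.

Lemma sectorE (R : realType) (T : finType) (p : T -> R * R) (D : {set T * T})
    (v w u : T) : succ p D v w = u ->
  sector p D (v, w) = ang (vec (p v) (p w)) (vec (p v) (p u)).
Proof. by move=> e; rewrite /sector /gap -/(succ p D v w) e. Qed.

Lemma fprev_neq (R : realType) (T : finType) (p : T -> R * R) (D : {set T * T})
    (d : T * T) : plane p D -> d \in D -> fprev p D d != d.
Proof.
case: d => v w pl vwD; apply/eqP => -[_ e]; move: vwD; rewrite -e.
by apply/negP; exact: (plane_irr pl).
Qed.

Lemma fprev2_neq (R : realType) (T : finType) (p : T -> R * R) (D : {set T * T})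
    (d : T * T) : sector p D d < 2 * pi -> fprev p D (fprev p D d) != d.
Proof.
case: d => v w; apply: contraTneq => -[_ e].
by rewrite -leNgt /sector /gap -/(succ p D v w) e cangxx.
Qed.

(** As the sum is [pi], every angle is below [pi]; this excludes 2-cycles, so the darts form one
    closed walk of three unit edges. The sum of [crs] is twice the area. *)
Lemma triangle_face (R : realType) (T : finType) (p : T -> R * R)
    (D A : {set T * T}) :
  injective p -> plane p D -> unit_edges p D -> A \subset D ->
  (forall d, d \in A -> fprev p D d \in A) -> #|A| = 3%N ->
  \sum_(d in A) sector p D d = pi ->
  (forall d, d \in A -> sector p D d = pi / 3) /\
  2 * \sum_(d in A) crs (p d.1) (p d.2) = Num.sqrt 3.
Proof.
move=> pinj pl unit AD fA cA sA.
have dir v := @plane_directions R T p D v pinj pl.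
have inD d : d \in A -> d \in D := subsetP AD d.
have spos d : d \in A -> 0 < sector p D d by move=> /inD /(sector_bnd dir) /andP[].
have slt d : d \in A -> sector p D d < pi.
  move=> dA; have [d' d'A] : exists2 d', d' \in A & d' != d.
    by exists (fprev p D d); [exact: fA | exact: fprev_neq (inD _ dA)].
  move=> d'd; rewrite -sA (big_setD1 d) //= ltrDl (big_setD1 d') ?inE ?d'd //=.
  rewrite ltr_pwDl ?spos //; apply: sumr_ge0 => e; rewrite !inE => /and3P[_ _ eA].
  exact: ltW (spos _ eA).
have [[v w] vwA] : exists d, d \in A by apply/set0Pn; rewrite -cards_eq0 cA.
have p0 := @pi_gt0 R.
have slt2 d : d \in A -> sector p D d < 2 * pi by move=> /slt; lra.
have [AE e3] := orbit_card3 fA (fun x y xA yA => fprev_inj dir (inD _ xA) (inD _ yA))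
  (fun d dA => fprev_neq pl (inD _ dA))
  (fun d dA => fprev2_neq (slt2 d dA)) cA vwA.
move: AE e3; rewrite /fprev /=.
set u := succ p D v w; set x := succ p D u v => AE [e4 e5].
have AE' : A = [set (v, w); (u, v); (w, u)] by rewrite AE e5.
rewrite e5 in e4; have {x AE e5} e5 : succ p D u v = w by [].
have uvA : (u, v) \in A by rewrite AE' !inE eqxx orbT.
have wuA : (w, u) \in A by rewrite AE' !inE eqxx orbT.
have uvec x y : (x, y) \in D -> norm2 (vec (p x) (p y)) = 1.
  by move=> xyD; rewrite /norm2 unit // sqrtr1.
have half a b c : (a, b) \in D -> (a, c) \in D -> (b, c) \in D -> succ p D a b = c ->
    cos (sector p D (a, b)) = 1 / 2 /\
    sin (sector p D (a, b)) = crs (vec (p a) (p b)) (vec (p a) (p c)).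
  move=> ab ac bc e; rewrite (sectorE e).
  have [] := ang_cos_sin (vec_neq0 pinj (plane_neq pl ab)) (vec_neq0 pinj (plane_neq pl ac)).
  rewrite !uvec // !mul1r => -> ->; split=> //.
  have := unit _ _ ab; have := unit _ _ ac; have := unit _ _ bc.
  rewrite /dot /vec /=; lra.
have sym := plane_sym pl.
have [vwD uvD wuD] := And3 (inD _ vwA) (inD _ uvA) (inD _ wuA).
have [c1 s1] := half _ _ _ vwD (sym _ _ uvD) wuD erefl.
have [c2 _] := half _ _ _ uvD (sym _ _ wuD) vwD e5.
have [c3 _] := half _ _ _ wuD (sym _ _ vwD) uvD e4.
have inpi d : d \in A -> sector p D d \in `[0, pi].
  by move=> dA; rewrite in_itv /= !ltW ?spos ?slt.
have e21 := cos_inj (inpi _ uvA) (inpi _ vwA) (etrans c2 (esym c1)).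
have e31 := cos_inj (inpi _ wuA) (inpi _ vwA) (etrans c3 (esym c1)).
have vw := plane_neq pl vwD; have uv := plane_neq pl uvD; have wu := plane_neq pl wuD.
have sum3 (F : T * T -> R) : \sum_(d in A) F d = F (v, w) + F (u, v) + F (w, u).
  rewrite AE' -setUA big_setU1 /=; last first.
    by rewrite !inE !xpair_eqE ![v == _]eq_sym (negbTE uv) [w == v]eq_sym (negbTE vw).
  rewrite big_setU1 /=; last by rewrite !inE !xpair_eqE [u == w]eq_sym (negbTE wu).
  by rewrite big_set1 addrA.
have sv : sector p D (v, w) = pi / 3 by move: sA; rewrite sum3 e21 e31; lra.
split.
  by move=> d; rewrite AE' !inE -orbA => /or3P[] /eqP -> //; rewrite ?e21 ?e31.
rewrite sum3 /=.
have -> : crs (p v) (p w) + crs (p u) (p v) + crs (p w) (p u) =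
    crs (vec (p v) (p w)) (vec (p v) (p u)) by rewrite /crs /vec /=; ring.
rewrite -s1.
have s0 : 0 < sin (sector p D (v, w)) by rewrite sin_gt0_pi // spos //= slt.
have nn : 0 <= 2 * sin (sector p D (v, w)) by lra.
apply/eqP; rewrite -(@eqrXn2 _ 2) ?sqrtr_ge0 //.
have -> : Num.sqrt 3 ^+ 2 = 3 :> R by rewrite sqr_sqrtr.
by rewrite exprMn sin2cos2 c1; apply/eqP; field.
Qed.

(** Opposite angles agree and adjacent ones are supplementary, so each adjacent pair has weight
    2. *)
Lemma rhombus_face (R : realType) (T : finType) (p : T -> R * R)
    (D A : {set T * T}) :
  injective p -> plane p D -> unit_edges p D -> A \subset D ->
  (forall d, d \in A -> fprev p D d \in A) -> #|A| = 4%N ->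
  \sum_(d in A) sector p D d = 2 * pi ->
  (\sum_(d in A) wide (sector p D d))%N = 4%N.
Proof.
move=> pinj pl unit AD fA cA sA.
have dir v := @plane_directions R T p D v pinj pl.
have inD d : d \in A -> d \in D := subsetP AD d.
have spos d : d \in A -> 0 < sector p D d by move=> /inD /(sector_bnd dir) /andP[].
have slt d : d \in A -> sector p D d < 2 * pi.
  move=> dA; have [d' d'A] : exists2 d', d' \in A & d' != d.
    by exists (fprev p D d); [exact: fA | exact: fprev_neq (inD _ dA)].
  move=> d'd; rewrite -sA (big_setD1 d) //= ltrDl (big_setD1 d') ?inE ?d'd //=.
  rewrite ltr_pwDl ?spos //; apply: sumr_ge0 => e; rewrite !inE => /and3P[_ _ eA].
  exact: ltW (spos _ eA).
have [[v w] vwA] : exists d, d \in A by apply/set0Pn; rewrite -cards_eq0 cA.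
have f2 d dA := fprev2_neq (slt d dA).
have [AE un e4] := orbit_card4 fA (fun x y xA yA => fprev_inj dir (inD _ xA) (inD _ yA))
  (fun d dA => fprev_neq pl (inD _ dA)) f2 cA vwA.
move: AE un e4; rewrite /fprev /=.
set u := succ p D v w; set x := succ p D u v; set y := succ p D x u => AE un [e4 e5].
rewrite e5 in AE un e4; have {y e5} e5 : succ p D x u = w by [].
have uvA : (u, v) \in A by rewrite AE !inE eqxx orbT.
have xuA : (x, u) \in A by rewrite AE !inE eqxx !orbT.
have wxA : (w, x) \in A by rewrite AE !inE eqxx !orbT.
have vwD := inD _ vwA; have uvD := inD _ uvA; have xuD := inD _ xuA; have wxD := inD _ wxA.
have xv : x != v.
  apply/eqP => e; have := slt _ uvA.
  by rewrite /sector /gap /= -/(succ p D u v) -/x e cangxx ltxx.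
have wu : w != u.
  apply/eqP => e; have := slt _ vwA.
  by rewrite /sector /gap /= -/(succ p D v w) -/u -e cangxx ltxx.
have sym := plane_sym pl.
pose a := vec (p v) (p w); pose b := vec (p v) (p u); pose c := vec (p v) (p x).
have a0 : a != (0, 0) := vec_neq0 pinj (plane_neq pl vwD).
have b0 : b != (0, 0) := vec_neq0 pinj (plane_neq pl (sym _ _ uvD)).
have cE : c = (a.1 + b.1, a.2 + b.2).
  apply: rhombus.
  - exact: unit.
  - exact: unit (sym _ _ uvD).
  - by apply: vec_neq0 => //; rewrite eq_sym.
  - apply: contra wu => /eqP [/eqP e1 /eqP e2]; apply/eqP/pinj.
    rewrite [p w]surjective_pairing [p u]surjective_pairing; congr (_, _).
      by move/eqP: e1; lra.
    by move/eqP: e2; lra.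
  - by have := unit _ _ wxD; rewrite /dot /vec /=; lra.
  - by have := unit _ _ (sym _ _ xuD); rewrite /dot /vec /=; lra.
have [c1 c2] : (p x).1 - (p v).1 = a.1 + b.1 /\ (p x).2 - (p v).2 = a.2 + b.2.
  by move: cE; rewrite /c /vec => -[-> ->].
have sv : sector p D (v, w) = ang a b by rewrite (@sectorE _ _ _ _ _ _ u).
have sx : sector p D (x, u) = ang a b.
  rewrite (@sectorE _ _ _ _ _ _ w) // -(ang_opp a0 b0); congr ang.
    by rewrite /vec /=; congr (_, _); move: c1 c2; rewrite /a /b /=; lra.
  by rewrite /vec /=; congr (_, _); move: c1 c2; rewrite /a /b /=; lra.
have su : sector p D (u, v) = ang (- b.1, - b.2) a.
  rewrite (@sectorE _ _ _ _ _ _ x) //; congr ang.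
    by rewrite /vec /=; congr (_, _); rewrite /b /=; ring.
  by rewrite /vec /=; congr (_, _); move: c1 c2; rewrite /a /b /=; lra.
have Nb0 : (- b.1, - b.2) != (0, 0).
  apply: contra b0 => /eqP [h1 h2]; apply/eqP; rewrite [b]surjective_pairing.
  by congr (_, _); [move: h1|move: h2] => /eqP; rewrite oppr_eq0 => /eqP.
have sw : sector p D (w, x) = ang (- b.1, - b.2) a.
  rewrite (@sectorE _ _ _ _ _ _ v) // -(ang_opp Nb0 a0); congr ang.
    by rewrite /vec /=; congr (_, _); move: c1 c2; rewrite /a /b /=; lra.
  by rewrite /vec /=; congr (_, _); move: c1 c2; rewrite /a /b /=; lra.
move: un; rewrite /= => /and4P[n1 n2 n3 _].
have sum4 (V : Type) (idx : V) (op : Monoid.com_law idx) (F : T * T -> V) :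
    \big[op/idx]_(d in A) F d = op (F (v, w)) (op (F (u, v)) (op (F (x, u)) (F (w, x)))).
  rewrite AE big_setU1 /=; last by move: n1; rewrite !inE.
  rewrite big_setU1 /=; last by move: n2; rewrite !inE.
  by rewrite big_setU1 /= ?big_set1 //; move: n3; rewrite !inE.
rewrite sum4 /= sv su sx sw.
have -> : ang (- b.1, - b.2) a = pi - ang a b.
  by move: sA; rewrite sum4 /= sv su sx sw; lra.
move: (wide_compl (ang a b)); move: (wide (ang a b)) (wide (pi - ang a b)) => i j.
by clear; lia.
Qed.

(** In the second estimate [k + 4 * j - 4] is negative only for the triangle, where the area
    [sqrt 3 / 4] compensates it exactly; elsewhere a nonnegative area is enough. *)
Lemma inner_face (R : realType) (T : finType) (p : T -> R * R)
    (D A : {set T * T}) (j : nat) :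
  injective p -> plane p D -> unit_edges p D -> A \subset D -> A != finset.set0 ->
  (forall d, d \in A -> fprev p D d \in A) ->
  \sum_(d in A) sector p D d + 2 * pi = pi * (#|A| + 2 * j)%:R ->
  0 <= \sum_(d in A) crs (p d.1) (p d.2) ->
  (\sum_(d in A) wide (sector p D d) + 12 <= 4 * #|A| + 12 * j)%N /\
  0 <= Num.sqrt 3 * (#|A|%:R + 4 * j%:R - 4) + 2 * \sum_(d in A) crs (p d.1) (p d.2).
Proof.
move=> pinj pl unit AD A0 fA sA area.
have dir v := @plane_directions R T p D v pinj pl.
have p0 := @pi_gt0 R.
have spos d : d \in A -> 0 < sector p D d.
  by move=> /(subsetP AD) /(sector_bnd dir) /andP[].
have Spos : 0 < \sum_(d in A) sector p D d.
  have /set0Pn[d dA] := A0; rewrite (big_setD1 d) //= ltr_pwDl ?spos //.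
  by apply: sumr_ge0 => e; rewrite !inE => /andP[_ /spos /ltW].
have k3 : (3 <= #|A| + 2 * j)%N.
  rewrite leqNgt; apply/negP; rewrite ltnS => k2.
  have : pi * (#|A| + 2 * j)%:R <= pi * 2 :> R by rewrite ler_pM2l // ler_nat.
  by rewrite -sA; lra.
have area_ok : (4 <= #|A| + 4 * j)%N -> 0 <= Num.sqrt 3 * (#|A|%:R + 4 * j%:R - 4)
    + 2 * \sum_(d in A) crs (p d.1) (p d.2).
  move=> k4; apply: addr_ge0; last by rewrite mulr_ge0.
  by rewrite mulr_ge0 ?sqrtr_ge0 // subr_ge0 -natrM -natrD ler_nat.
have wide2 : (\sum_(d in A) wide (sector p D d) <= 2 * #|A|)%N.
  rewrite -sum1_card big_distrr /=; apply: leq_sum => d _.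
  by rewrite muln1 wide_le2.
(* Weights of at most 2 suffice once [k + 6 * j >= 6]. What remains is [j = 0] with 3, 4 or 5
   sides. *)
have [big|small] := leqP 6 (#|A| + 6 * j)%N.
  by split; [move: big wide2; lia | apply: area_ok; move: big k3; lia].
have j0 : j = 0%N by move: small; lia.
rewrite {j}j0 !muln0 !addn0 in sA k3 small area_ok *.
have [k4|k3'] := leqP 4 #|A|; last first.
  have cA : #|A| = 3%N by move: k3 k3'; lia.
  have sA' : \sum_(d in A) sector p D d = pi by move: sA; rewrite cA; lra.
  have [sec ar] := triangle_face pinj pl unit AD fA cA sA'.
  split; last by rewrite ar cA; lra.
  rewrite big1 ?cA // => d dA; by rewrite /wide sec // lexx.
split; last exact: area_ok.
have [k5|k4'] := leqP 5 #|A|; last first.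
  have cA : #|A| = 4%N by move: k4 k4'; lia.
  have sA' : \sum_(d in A) sector p D d = 2 * pi by move: sA; rewrite cA; lra.
  by rewrite (rhombus_face pinj pl unit AD fA cA sA') cA.
have cA : #|A| = 5%N by move: k5 small; lia.
have sA' : \sum_(d in A) sector p D d = 3 * pi by move: sA; rewrite cA; lra.
(* The linear bound gives 9 where 8 is needed; equality would make all five angles [2 * pi / 3],
   against the sum [3 * pi]. *)
suff : (\sum_(d in A) wide (sector p D d) < 9)%N.
  by rewrite cA; clear; move: (\sum_(d in A) _)%N => N; lia.
rewrite -(ltr_nat R) -(ltr_pM2l p0) natr_sum.
have -> : pi * 9%:R = 3 * \sum_(d in A) sector p D d :> R by rewrite sA'; ring.
rewrite !mulr_sumr.
have le d : d \in A -> pi * (wide (sector p D d))%:R <= 3 * sector p D d.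
  by move=> /spos; exact: wide_linear.
have [d dA ne] : exists2 d, d \in A & 3 * sector p D d != 2 * pi.
  apply/exists_inP; apply: contraT => /exists_inPn all.
  have : \sum_(d in A) 3 * sector p D d = \sum_(d in A) 2 * pi.
    by apply: eq_bigr => d dA; have := all d dA; rewrite negbK => /eqP.
  rewrite -mulr_sumr sA' sumr_const cA -mulr_natl; lra.
rewrite (big_setD1 d) //= [ltRHS](big_setD1 d) //=; apply: ltr_leD.
  rewrite lt_neqAle le // andbT; apply: contra ne => /eqP e; apply/eqP.
  by apply: wide_linear_eq e; exact: spos.
by apply: ler_sum => e; rewrite !inE => /andP[_ /le].
Qed.

(** * Counting *)

Lemma wide_linear_low (R : realType) (th : R) :
  th < 2 * pi / 3 -> 3 * th - pi <= pi * (wide th)%:R.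
Proof.
move=> th1; rewrite /wide th1; have := @pi_gt0 R.
by case: (leP th (pi / 3)) => h1; lra.
Qed.

(** Degree 6 suffices without weights. A vertex of degree 1 has the 8 and a full turn of weight 2.
    For degree 5 either some gap has weight 2, or the weights times [pi] dominate the terms
    [3 * th - pi], whose sum is [pi]; a gap above [pi / 3] makes this strict, so the weights exceed
    1. *)
Lemma wide_around (R : realType) (T : finType) (al : T -> R) (N : {set T}) :
  directions al N -> N != finset.set0 ->
  (12 <= 2 * #|N| + \sum_(w in N) wide (gap al N w) + 8 * (#|N| <= 4))%N.
Proof.
move=> d N0; have S := sum_gap d N0; have p0 := @pi_gt0 R.
have n1 : (0 < #|N|)%N by rewrite card_gt0.
have [k1|k1] := leqP #|N| 1.
  have /cards1P[w Nw] : #|N| == 1%N by rewrite eqn_leq k1.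
  move: S; rewrite Nw !big_set1 cards1 => ->.
  by rewrite /wide !ifF //; apply/negbTE; rewrite -?ltNge -?leNgt; lra.
have [k4|k4] := leqP #|N| 4; first by move: k1; clear; lia.
have [k6|k6] := leqP 6 #|N|; first by move: k6; clear; lia.
have cN : #|N| = 5%N by move: k4 k6; clear; lia.
suff : (2 <= \sum_(w in N) wide (gap al N w))%N by rewrite cN; clear; lia.
have [/exists_inP[w wN wide2]|/exists_inPn narrow] :=
    boolP [exists w in N, 2 * pi / 3 <= gap al N w].
  rewrite (big_setD1 w) //= (leq_trans _ (leq_addr _ _)) //.
  by rewrite /wide !ifF //; apply/negbTE; rewrite -?ltNge -?leNgt //; move: wide2; lra.
have {}narrow w : w \in N -> gap al N w < 2 * pi / 3.
  by move=> /narrow; rewrite -ltNge.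
have [w wN wgt] : exists2 w, w \in N & pi / 3 < gap al N w.
  apply/exists_inP; apply: contraT => /exists_inPn all.
  have : \sum_(w in N) gap al N w <= \sum_(w in N) pi / 3.
    by apply: ler_sum => w /all; rewrite -leNgt.
  by rewrite S sumr_const cN -mulr_natl; lra.
rewrite -(ltr_nat R) natr_sum -(ltr_pM2l p0) mulr1 mulr_sumr.
have piE : \sum_(w in N) (3 * gap al N w - pi) = pi.
  rewrite sumrB -mulr_sumr S sumr_const cN -[_ *+ 5]mulr_natl; ring.
rewrite -[ltLHS]piE (big_setD1 w) //= [ltRHS](big_setD1 w) //=; apply: ltr_leD.
  have -> : wide (gap al N w) = 1%N by rewrite /wide leNgt wgt narrow.
  by rewrite mulr1; have := narrow _ wN; lra.
by apply: ler_sum => u; rewrite !inE => /andP[_ /narrow]; exact: wide_linear_low.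
Qed.

Lemma sum_darts (V : nmodType) (T : finType) (D : {set T * T}) (F : T * T -> V) :
  \sum_(d in D) F d = \sum_v \sum_(w in nbh D v) F (v, w).
Proof.
rewrite pair_big_dep /=; apply: eq_big => [[v w]|[v w] _] //=.
by rewrite inE.
Qed.

Lemma sum_labels (V : nmodType) (T L : finType) (D : {set T * T})
    (l : T * T -> option L) (F : T * T -> V) :
  \sum_(d in D) F d = \sum_(d in region D l None) F d
    + \sum_X \sum_(d in region D l (Some X)) F d.
Proof.
rewrite sum_region; under [X in _ + X]eq_bigr do rewrite sum_region.
rewrite exchange_big /= -big_split /=; apply: eq_bigr => d _.
case: (l d) => [Y|] /=.
  rewrite add0r (bigD1 Y) //= eqxx big1 ?addr0 // => X XY.
  by case: eqP => // -[e]; rewrite e eqxx in XY.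
by rewrite big1 ?addr0.
Qed.

Lemma sum_crs0 (R : realType) (T : finType) (p : T -> R * R) (D : {set T * T}) :
  (forall x y, (x, y) \in D -> (y, x) \in D) ->
  \sum_(d in D) crs (p d.1) (p d.2) = 0.
Proof.
move=> sym; pose f (d : T * T) := (d.2, d.1).
have ff : involutive f by case.
have e : \sum_(d in D) crs (p d.1) (p d.2) = - \sum_(d in D) crs (p d.1) (p d.2).
  rewrite {1}(reindex_inj (inv_inj ff)) -sumrN; apply: eq_big => [[a b]|[a b] _].
    by apply/idP/idP; exact: sym.
  by rewrite /crs /=; ring.
by move: e; lra.
Qed.

(** Extended by the identity outside [D], [fprev] is a permutation, and its cycles in [A] are closed
    walks with unit steps. It runs backwards, which only changes the sign. *)
Lemma outer_area_le (R : realType) (T : finType) (p : T -> R * R)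
    (D A : {set T * T}) :
  injective p -> plane p D -> unit_edges p D -> A \subset D ->
  (forall d, d \in D -> (fprev p D d \in A) = (d \in A)) ->
  `|\sum_(d in A) crs (p d.1) (p d.2)| <= #|A|%:R ^+ 2 / (2 * pi).
Proof.
move=> pinj pl unit AD fA.
have dir v := @plane_directions R T p D v pinj pl.
have sym := plane_sym pl.
pose f d := if d \in D then fprev p D d else d.
have fi : injective f.
  move=> x y; rewrite /f; case: ifPn => xD; case: ifPn => yD //.
  - exact: fprev_inj.
  - by move=> e; rewrite -e fprev_in in yD.
  - by move=> e; rewrite e fprev_in in xD.
pose s := perm fi.
have sE d : d \in A -> s d = fprev p D d.
  by move=> /(subsetP AD) dD; rewrite permE /f dD.
have sA d : (s d \in A) = (d \in A).
  rewrite permE /f; case: ifPn => dD //; exact: fA.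
have -> : \sum_(d in A) crs (p d.1) (p d.2) = - \sum_(d in A) crs (p d.1) (p (s d).1).
  rewrite (reindex_inj (@perm_inj _ s)) -sumrN; apply: eq_big => [d|d].
    exact: sA.
  by rewrite sA => dA; rewrite sE // /crs /=; ring.
rewrite normrN; apply: (@perm_area_le R _ s A (fun d => p d.1)).
  by move=> d; rewrite sA.
move=> d dA; rewrite sE //=.
have := unit d.1 (succ p D d.1 d.2); rewrite /dot /vec /= -!expr2; apply.
have := fprev_in p sym (subsetP AD _ dA); exact: sym.
Qed.

Lemma low_degree_count (R : realType) (T : finType) (p : T -> R * R)
    (D : {set T * T}) (v0 : T) :
  injective p -> plane p D -> unit_edges p D ->
  pi * Num.sqrt 3 * #|T|%:R < 16 * #|[set v | (#|nbh D v| <= 4)%N]|%:R ^+ 2 :> R.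
Proof.
move=> pinj pl unit.
have dir v := @plane_directions R T p D v pinj pl.
have p0 := @pi_gt0 R; have p2 := @pi_ge2 R.
have p4 : pi < 4 :> R by have := @pihalf_lt2 R; lra.
have q2 : Num.sqrt 3 ^+ 2 = 3 :> R by rewrite sqr_sqrtr.
have q0 : 0 <= Num.sqrt 3 :> R := sqrtr_ge0 _.
have [q15 q20] : 3 / 2 <= Num.sqrt 3 :> R /\ Num.sqrt 3 <= 2 :> R by split; nra.
have [l fl] := faces_plane v0 pinj pl.
have [lf la lA lo] := fl.
have sym := plane_sym pl.
set low := [set v | _]; set n := #|T|.
have nbh0 v : nbh D v != finset.set0.
  by have [w vw] := plane_cover pl v; apply/set0Pn; exists w; rewrite inE.
have fsub c : region D l c \subset D by apply/subsetP => d; rewrite inE => /andP[].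
have ffix c d : d \in D -> (fprev p D d \in region D l c) = (d \in region D l c).
  by move=> dD; rewrite !inE lf // fprev_in // dD.
pose S c := \sum_(d in region D l c) sector p D d.
pose K c : R := \sum_(d in region D l c) 1.
pose W c : R := \sum_(d in region D l c) (wide (sector p D d))%:R.
pose C c := \sum_(d in region D l c) crs (p d.1) (p d.2).
have KE c : K c = #|region D l c|%:R by rewrite /K sumr_const.
(* The angle sum eliminates [j], so that both bounds become linear and can be added over all
   labels. *)
have inner X : pi * W (Some X) <= 6 * S (Some X) - 2 * pi * K (Some X) /\
    0 <= Num.sqrt 3 * (2 * S (Some X) - pi * K (Some X)) + 2 * pi * C (Some X).
  have [X0|X0] := eqVneq (region D l (Some X)) finset.set0.
    by rewrite /W /S /K /C X0 !big_set0; split; lra.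
  have [j sj] := la X X0.
  have [|h1 h2] := inner_face pinj pl unit (fsub _) X0 _ sj (lA X).
    by move=> d dA; rewrite ffix // (subsetP (fsub (Some X))).
  have {}h1 : W (Some X) + 12 <= 4 * K (Some X) + 12 * j%:R.
    by rewrite /W KE -natr_sum -!natrM -!natrD ler_nat.
  rewrite natrD natrM -KE -/(S _) in sj; rewrite -KE -/(C _) in h2.
  split; first by move: h1; rewrite -(ler_pM2l p0); lra.
  have -> : 2 * S (Some X) - pi * K (Some X) = pi * (K (Some X) + 4 * j%:R - 4).
    by move: sj; lra.
  have -> : Num.sqrt 3 * (pi * (K (Some X) + 4 * j%:R - 4)) + 2 * pi * C (Some X) =
    pi * (Num.sqrt 3 * (K (Some X) + 4 * j%:R - 4) + 2 * C (Some X)) by ring.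
  by rewrite mulr_ge0 // ltW.
pose Sin := \sum_X S (Some X); pose Kin := \sum_X K (Some X).
pose Win := \sum_X W (Some X); pose Cin := \sum_X C (Some X).
have inW : pi * Win <= 6 * Sin - 2 * pi * Kin.
  rewrite /Win /Sin /Kin !mulr_sumr -sumrB; apply: ler_sum => X _; exact: (inner X).1.
have inC : 0 <= Num.sqrt 3 * (2 * Sin - pi * Kin) + 2 * pi * Cin.
  rewrite /Cin /Sin /Kin !mulr_sumr -sumrB mulr_sumr -big_split /=.
  by apply: sumr_ge0 => X _; exact: (inner X).2.
have totS : S None + Sin = 2 * pi * n%:R.
  rewrite /S /Sin -sum_labels sum_darts mulr_natr -sumr_const.
  by apply: eq_bigr => v _; exact: (sum_gap (dir v) (nbh0 v)).
have totK : K None + Kin = #|D|%:R by rewrite /K /Kin -sum_labels sumr_const.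
have totC : C None + Cin = 0 by rewrite /C /Cin -sum_labels sum_crs0.
have totW : W None + Win = (\sum_v \sum_(w in nbh D v) wide (sector p D (v, w)))%:R.
  rewrite /W /Win -sum_labels sum_darts natr_sum; apply: eq_bigr => v _.
  by rewrite natr_sum.
have cardD : #|D| = (\sum_v #|nbh D v|)%N.
  rewrite -sum1_card sum_darts; apply: eq_bigr => v _; exact: sum1_card.
have lowE : #|low| = (\sum_v (#|nbh D v| <= 4)%N)%N.
  rewrite -sum1_card big_mkcond; apply: eq_bigr => v _ /=.
  by rewrite inE; case: (_ <= 4)%N.
have nE : n = (\sum_(v : T) 1)%N by rewrite sum1_card.
have deg5 : (5 * n <= #|D| + 4 * #|low|)%N.
  rewrite cardD lowE nE !big_distrr -big_split /=; apply: leq_sum => v _.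
  have : (0 < #|nbh D v|)%N by rewrite card_gt0.
  by move: #|nbh D v| => k; clear; lia.
have angles : (12 * n <= 2 * #|D| + (\sum_v \sum_(w in nbh D v) wide (sector p D (v, w)))
    + 8 * #|low|)%N.
  rewrite cardD lowE nE !big_distrr -!big_split /=; apply: leq_sum => v _.
  by rewrite muln1; exact: (wide_around (dir v) (nbh0 v)).
set m : R := #|low|%:R; set N : R := n%:R in totS *.
have {}deg5 : 5 * N <= K None + Kin + 4 * m by rewrite totK -!natrM -!natrD ler_nat.
have {}angles : 12 * N <= 2 * (K None + Kin) + (W None + Win) + 8 * m.
  by rewrite totK totW -!natrM -!natrD ler_nat.
have Wo : W None <= 2 * K None.
  rewrite /W /K mulr_sumr; apply: ler_sum => d _.
  by rewrite mulr1 ler_nat wide_le2.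
rewrite -KE in lo; rewrite -/(S None) in lo.
have Co : - C None <= K None ^+ 2 / (2 * pi).
  rewrite KE; apply: le_trans (outer_area_le pinj pl unit (fsub None) _).
    by rewrite ler_normr lexx orbT.
  by move=> d; exact: ffix.
have {}Co : - (2 * pi * C None) <= K None ^+ 2.
  by move: Co; rewrite ler_pdivlMr ?mulr_gt0 //; lra.
have Ko0 : 0 <= K None by rewrite KE.
(* Since [12 * pi * N = 6 * (S None + Sin)], the bounded regions cancel and leave
   [6 * S None <= pi * (4 * K None + 8 * m)], where [S None] exceeds [pi * K None]. *)
have Km : K None < 4 * m.
  rewrite -(ltr_pM2l p0).
  have : pi * (12 * N) <= pi * (2 * (K None + Kin) + (W None + Win) + 8 * m).
    by rewrite ler_pM2l.
  have : pi * W None <= pi * (2 * K None) by rewrite ler_pM2l.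
  by move: inW lo totS; lra.
have bound : Num.sqrt 3 * pi * (N + K None - 4 * m) <= K None ^+ 2.
  have h1 : pi * (5 * N) <= pi * (K None + Kin + 4 * m) by rewrite ler_pM2l.
  have h2 : 2 * Sin - pi * Kin <= pi * (4 * m - N - K None).
    by move: h1 lo totS; lra.
  have h3 : 2 * pi * Cin <= K None ^+ 2.
    by have -> : Cin = - C None; [move: totC; lra | move: Co; lra].
  have h4 : Num.sqrt 3 * (2 * Sin - pi * Kin) <= Num.sqrt 3 * (pi * (4 * m - N - K None)).
    by rewrite ler_wpM2l.
  by move: inC h3 h4; lra.
have x3 : 3 <= Num.sqrt 3 * pi :> R.
  by apply: (@le_trans _ _ (3 / 2 * 2)); [lra|apply: ler_pM => //; lra].
have x8 : Num.sqrt 3 * pi < 8 :> R.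
  apply: (@le_lt_trans _ _ (2 * pi)); first by rewrite ler_wpM2r // ltW.
  by move: p4; lra.
(* If [m <= 1], then [K None <= 3] and [bound] gives [n <= 4]. All degrees are then at most 4, yet
   the two ends of an edge are two vertices of low degree. *)
have m2 : (2 <= #|low|)%N.
  rewrite leqNgt; apply/negP; rewrite ltnS => m1.
  have m1' : m <= 1 by rewrite /m -[1]/(1%:R) ler_nat.
  have K3 : K None <= 3.
    have : K None < 4%:R by move: Km m1'; lra.
    by rewrite KE ltr_nat ltnS -(ler_nat R).
  have n4 : (n <= 4)%N.
    rewrite -(ler_nat R) -/N leNgt; apply/negP => n4.
    have : 3 * (N + K None - 4 * m) <= K None ^+ 2.
      by apply: le_trans bound; rewrite ler_wpM2r //; move: Ko0 m1' n4; lra.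
    by move: Ko0 K3 m1' n4; nra.
  have lowT : low = [set: T].
    by apply/setP => v; rewrite !inE (leq_trans (max_card _)).
  have [w v0w] := plane_cover pl v0.
  have := subset_leq_card (subsetT [set v0; w]).
  by rewrite cards2 (plane_neq pl v0w) -lowT => /leq_trans /(_ m1).
have m2' : 2 <= m by rewrite /m -[2]/(2%:R) ler_nat.
(* Expanded, this is [K ^ 2 + sqrt 3 * pi * (4 * m - K) < 16 * m ^ 2] for [K = K None]. The second
   factor is positive because [4 * m >= 8 > sqrt 3 * pi]. *)
have : 0 < (4 * m - K None) * (4 * m + K None - Num.sqrt 3 * pi).
  by apply: mulr_gt0; move: Km Ko0 m2' x8; lra.
by move: bound; lra.
Qed.

(** * Isolated vertices and the final count *)

Definition active (T : finType) (e : rel T) : predArgType := {v : T | [exists w, e v w]}.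

Definition darts (T : finType) (e : rel T) : {set active e * active e} :=
  [set d | e (val d.1) (val d.2)].

Lemma val_set2 (T : finType) (e : rel T) (a b : active e) :
  val @: [set a; b] = [set val a; val b].
Proof. by rewrite imsetU !imset_set1. Qed.

Lemma matchstick_plane (R : realType) (T : finType) (e : rel T) (p : T -> R * R) :
  matchstick_graph e p -> plane (fun v : active e => p (val v)) (darts e).
Proof.
move=> [esym eirr pinj eunit ecross]; split.
- by move=> x y; rewrite !inE esym.
- by move=> x; rewrite inE eirr.
- move=> x; have /existsP[w xw] := valP x.
  have wP : [exists v, e w v] by apply/existsP; exists (val x); rewrite esym.
  by exists (Sub w wP); rewrite inE SubK.
- move=> x y; rewrite inE => xy a b z; rewrite inE => ab ne zab zxy.
  have ne' : [set val a; val b] != [set val x; val y].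
    by apply: contra ne; rewrite -!val_set2 => /eqP /(imset_inj val_inj) ->.
  have [c] := ecross _ _ _ _ _ ab xy ne' zab zxy.
  rewrite -!val_set2 => -[/imsetP[c' c'ab ->] c'xy zc]; exists c'; split=> //.
  by move: c'xy; rewrite mem_imset //; exact: val_inj.
Qed.

Lemma card_nbh_darts (T : finType) (e : rel T) (v : active e) :
  symmetric e -> #|nbh (darts e) v| = deg e (val v).
Proof.
move=> esym; rewrite /deg -(card_imset _ val_inj); congr #|pred_of_set _|.
apply/setP => w; rewrite !inE; apply/imsetP/idP => [[u]|vw].
  by rewrite !inE => vu ->.
have wP : [exists x, e w x] by apply/existsP; exists (val v); rewrite esym.
by exists (Sub w wP); rewrite ?inE SubK.
Qed.

(** Without edges both sides would be 0 and the strict inequality would fail, hence the separate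
    case. *)
Lemma active_count (R : realType) (T : finType) (e : rel T) (p : T -> R * R) :
  matchstick_graph e p ->
  #|active e| = 0%N \/
  pi * Num.sqrt 3 * #|active e|%:R
    < 16 * #|[set v : active e | (deg e (val v) <= 4)%N]|%:R ^+ 2 :> R.
Proof.
move=> mg; case: (posnP #|active e|) => [->|/card_gt0P[v0 _]]; [by left|right].
have pl := matchstick_plane mg; have [esym _ pinj eunit _] := mg.
have := @low_degree_count R (active e) _ (darts e) v0 _ pl.
have -> : [set v | (#|nbh (darts e) v| <= 4)%N] = [set v : active e | (deg e (val v) <= 4)%N].
  by apply/setP => v; rewrite !inE card_nbh_darts.
apply; first by move=> u v /pinj /val_inj.
move=> u v; rewrite inE => /eunit; rewrite /eucl_dist => d1.
rewrite -[RHS](expr1n _ 2) -d1 sqr_sqrtr ?addr_ge0 ?sqr_ge0 //.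
by rewrite /dot /vec /=; ring.
Qed.

Unset Implicit Arguments.

Theorem corollary2 (R : realType) (n : nat) (T : finType) (e : rel T)
    (p : T -> R * R)
    (hn : (1 <= n)%N) (hT : #|T| = n) (hG : matchstick_graph e p) :
  1 / 4 * Num.sqrt (pi * Num.sqrt 3 * n%:R)
    < #|[set v : T | (deg e v <= 4)%N]|%:R :> R.
Proof.
set low := [set v | _].
pose iso := [set v : T | ~~ [exists w, e v w]].
pose low' := [set v : active e | (deg e (val v) <= 4)%N].
have nE : n = (#|active e| + #|iso|)%N.
  rewrite -hT card_sig -(cardC (fun v => [exists w, e v w])); congr addn.
  by apply: eq_card => v; rewrite !inE.
have mE : (#|low'| + #|iso| <= #|low|)%N.
  rewrite -(card_imset low' val_inj).
  have dis : [disjoint val @: low' & iso].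
    apply/pred0P => v /=; rewrite !inE; apply/negP => /andP[/imsetP[u _ ->]].
    by rewrite (valP u).
  move: dis; rewrite -leq_card_setU => /eqP <-; apply: subset_leq_card.
  apply/subsetP => v; rewrite !inE => /orP[/imsetP[u]|]; first by rewrite inE => ud ->.
  move=> /existsPn iv; rewrite /deg; suff -> : [set w | e v w] = finset.set0 by rewrite cards0.
  by apply/setP => w; rewrite !inE; apply/negbTE.
have p0 := @pi_gt0 R.
have p4 : pi < 4 :> R by have := @pihalf_lt2 R; lra.
have q2 : Num.sqrt 3 ^+ 2 = 3 :> R by rewrite sqr_sqrtr.
have q0 : 0 <= Num.sqrt 3 :> R := sqrtr_ge0 _.
have q20 : Num.sqrt 3 <= 2 :> R by nra.
(* With [i] isolated vertices the left side grows by [pi * sqrt 3 * i <= 8 * i ^ 2], the right side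
   by at least [16 * i ^ 2]. If there are no edges, [i >= 1] gives strictness. *)
have key : pi * Num.sqrt 3 * n%:R < (4 * #|low|%:R) ^+ 2 :> R.
  have i2 : #|iso|%:R <= #|iso|%:R ^+ 2 :> R.
    by rewrite -natrX ler_nat; case: #|iso| => // k; rewrite leq_pmulr.
  have x8 : pi * Num.sqrt 3 <= 8 :> R by nra.
  have x0 : 0 <= pi * Num.sqrt 3 :> R by rewrite mulr_ge0 // ltW.
  have mR : #|low'|%:R + #|iso|%:R <= #|low|%:R :> R by rewrite -natrD ler_nat.
  have l0 : 0 <= #|low'|%:R :> R by [].
  have i0 : 0 <= #|iso|%:R :> R by [].
  rewrite nE natrD.
  have [a0|lt] := active_count hG.
    have i1 : 1 <= #|iso|%:R :> R.
      by rewrite -[1]/(1%:R) ler_nat; move: hn; rewrite nE a0.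
    by rewrite a0; nra.
  by move: lt; rewrite -/low'; nra.
have l0 : 0 <= 4 * #|low|%:R :> R by rewrite mulr_ge0.
have lpos : 0 < (4 * #|low|%:R) ^+ 2 :> R.
  by apply: le_lt_trans key; rewrite !mulr_ge0 // ltW.
have : Num.sqrt (pi * Num.sqrt 3 * n%:R) < 4 * #|low|%:R :> R.
  by rewrite -(ger0_norm l0) -sqrtr_sqr ltr_sqrt.
by lra.
Qed.
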